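(* Let $\Gamma$ be the fundamental group of a graph of groups in which every edge group is cyclic and every vertex group is either (isomorphic to) a subgroup of the additive group of rational numbers or a solvable Baumslag-Solitar group. If $\Gamma$ satisfies the analytic zero-divisor conjecture, then $\Gamma$ is almost coherent.
   Context: All groups are discrete. The solvable Baumslag-Solitar groups are the groups $BS(1,m)=\langle a,t \mid t^{-1}at=a^m\rangle$ with $m$ a non-zero integer. The fundamental group of a graph of groups is in the sense of Bass-Serre theory. A group $G$ satisfies the analytic zero-divisor conjecture if for all $\alpha\in\mathbb{C}[G]\setminus\{0\}$ and $\beta\in l^2(G)\setminus\{0\}$ one has $\alpha\beta\neq 0$, where $l^2(G)$ is the space of formal sums $\sum_{g\in G}a_g g$ with $a_g\in\mathbb{C}$ and $\sum_{g}|a_g|^2<\infty$, and the product of $\alpha=\sum a_g g$ and $\beta=\sum b_h h$ is $\sum_{g}\big(\sum_{h}a_{gh^{-1}}b_h\big)g$. A group is almost coherent if every finitely generated subgroup is almost finitely presented, i.e. of type $FP_2$. A group $G$ is of type $FP_2$ if there is a projective $\mathbb{Z}[G]$-resolution $P_*$ of the trivial module $\mathbb{Z}$ with $P_d$ finitely generated for all $0\le d\le 2$. *)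

(* Defs.v *)
From HB Require Import structures.
From mathcomp Require Import all_boot all_order all_algebra finmap.
From mathcomp Require Import monalg complex.
From mathcomp Require Import boolp classical_sets fsbigop reals ereal esum.

Set Implicit Arguments.
Unset Strict Implicit.
Unset Printing Implicit Defensive.

Import GRing.Theory Num.Theory.

Local Open Scope ring_scope.
Local Open Scope quotient_scope.

Section Subgroup.
Variables (G : groupType) (H : groupClosed G).

Definition subgrp : Type := {x : G | x \in H}.

HB.instance Definition _ := SubChoice.on subgrp.

Fact subgrp_closed : group_closed (fun x : G => x \in H).
Proof. by split=> [|x y Hx Hy]; [exact: gpred1 | exact: gpredF]. Qed.

HB.instance Definition _ :=
  SubChoice_isSubGroup.Build G (fun x => x \in H) subgrp subgrp_closed.

End Subgroup.

Definition finitely_generated (G : groupType) : Prop :=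
  exists S : seq G,
    forall K : groupClosed G, {subset S <= K} -> forall x : G, x \in K.

Definition cyclic_group (G : groupType) : Prop :=
  exists g : G, forall x : G, exists n : nat, x = (g ^+ n)%g \/ x = (g ^- n)%g.

Definition group_isomorphic (G H : groupType) : Prop :=
  exists f : {multiplicative G -> H}, bijective f.

Definition isomorphic_to_subgroup_of_rat (G : groupType) : Prop :=
  exists (A : zmodClosed rat) (f : G -> rat),
    [/\ {morph f : x y / (x * y)%g >-> x + y}, injective f
      & forall q : rat, q \in A <-> exists x : G, f x = q].

Section Presented.
Variable X : choiceType.

(* The letter [(x, false)] is the generator [x], [(x, true)] its inverse. *)
Definition word := seq (X * bool).

Definition inv_word (w : word) : word := rev [seq (l.1, ~~ l.2) | l <- w].

Variable rel : word -> word -> Prop.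

Inductive word_eq : word -> word -> Prop :=
| WordRefl u : word_eq u u
| WordSym u v : word_eq u v -> word_eq v u
| WordTrans u v w : word_eq u v -> word_eq v w -> word_eq u w
| WordCat u u' v v' :
    word_eq u u' -> word_eq v v' -> word_eq (u ++ v) (u' ++ v')
| WordCancel x b : word_eq [:: (x, b); (x, ~~ b)] [::]
| WordRel u v : rel u v -> word_eq u v.

Definition word_eqb (u v : word) : bool := `[< word_eq u v >].

Fact word_eqb_refl : reflexive word_eqb.
Proof. by move=> u; apply/asboolP; apply: WordRefl. Qed.

Fact word_eqb_sym : symmetric word_eqb.
Proof. by move=> u v; apply/asboolP/asboolP => ?; apply: WordSym. Qed.

Fact word_eqb_trans : transitive word_eqb.
Proof.
by move=> v u w /asboolP uv /asboolP vw; apply/asboolP; apply: WordTrans uv vw.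
Qed.

Canonical word_equiv :=
  EquivRel word_eqb word_eqb_refl word_eqb_sym word_eqb_trans.

Definition presented : Type := {eq_quot word_equiv}.

HB.instance Definition _ := Choice.on presented.

Definition pres_class (w : word) : presented := \pi_{eq_quot word_equiv} w.
Definition pres_repr (x : presented) : word :=
  repr (x : {eq_quot word_equiv}).

Lemma pres_reprK x : pres_class (pres_repr x) = x.
Proof. exact: reprK. Qed.

Lemma pres_classP u v : pres_class u = pres_class v <-> word_eq u v.
Proof.
by split=> [/eqmodP/asboolP //|uv]; apply/eqmodP/asboolP.
Qed.

Lemma pres_classK u : word_eq (pres_repr (pres_class u)) u.
Proof. by apply/pres_classP; rewrite pres_reprK. Qed.

Definition pres_mul (x y : presented) := pres_class (pres_repr x ++ pres_repr y).
Definition pres_one := pres_class [::].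
Definition pres_inv (x : presented) := pres_class (inv_word (pres_repr x)).

Lemma pres_classM u v : pres_mul (pres_class u) (pres_class v) = pres_class (u ++ v).
Proof. by apply/pres_classP; apply: WordCat; apply: pres_classK. Qed.

Fact pres_mulA : associative pres_mul.
Proof.
by move=> x y z; rewrite -[x]pres_reprK -[y]pres_reprK -[z]pres_reprK
  !pres_classM catA.
Qed.

Fact pres_mul1 : left_id pres_one pres_mul.
Proof. by move=> x; rewrite -[x]pres_reprK pres_classM. Qed.

Fact pres_mulr1 : right_id pres_one pres_mul.
Proof. by move=> x; rewrite -[x]pres_reprK pres_classM cats0. Qed.

Lemma inv_word_cons l w : inv_word (l :: w) = inv_word w ++ [:: (l.1, ~~ l.2)].
Proof. by rewrite /inv_word /= rev_cons cats1. Qed.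

Lemma inv_wordK : involutive inv_word.
Proof.
move=> w; rewrite /inv_word map_rev revK -map_comp -[RHS]map_id.
by apply: eq_map => -[x b] /=; rewrite negbK.
Qed.

Lemma word_invr w : word_eq (w ++ inv_word w) [::].
Proof.
elim: w => [|[x b] w IHw]; first exact: WordRefl.
rewrite inv_word_cons catA /= -cat1s.
apply: (WordTrans (v := [:: (x, b)] ++ [:: (x, ~~ b)])); last exact: WordCancel.
apply: (WordCat (WordRefl [:: (x, b)])).
exact: (WordCat IHw (WordRefl [:: (x, ~~ b)])).
Qed.

Fact pres_mulrV : right_inverse pres_one pres_inv pres_mul.
Proof.
move=> x; rewrite -{1}[x]pres_reprK pres_classM.
exact/pres_classP/word_invr.
Qed.

Fact pres_mulVr : left_inverse pres_one pres_inv pres_mul.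
Proof.
move=> x; rewrite -{2}[x]pres_reprK pres_classM; apply/pres_classP.
by rewrite -{2}[pres_repr x]inv_wordK; apply: word_invr.
Qed.

HB.instance Definition _ := isGroup.Build presented
  pres_mulA pres_mul1 pres_mulr1 pres_mulVr pres_mulrV.

Definition pres_gen (x : X) : presented := pres_class [:: (x, false)].

End Presented.

(* The generators [a] and [t] are encoded as [false] and [true]. *)
Definition bs_a (inverse : bool) : bool * bool := (false, inverse).
Definition bs_t (inverse : bool) : bool * bool := (true, inverse).

Inductive bs_rel (m : int) : word bool -> word bool -> Prop :=
| BSRel : bs_rel m [:: bs_t true; bs_a false; bs_t false]
                   (nseq `|m|%N (bs_a (m < 0))).

(* [BS(1, m) = < a, t | t^-1 a t = a^m >]. *)
Definition BS1 (m : int) : groupType := presented (bs_rel m).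

Definition is_solvable_BS (G : groupType) : Prop :=
  exists m : int, m != 0 /\ group_isomorphic G (BS1 m).

Inductive walk (V E : Type) (src tgt : E -> V) : V -> V -> Prop :=
| WalkNil v : walk src tgt v v
| WalkFwd u e : walk src tgt u (src e) -> walk src tgt u (tgt e)
| WalkBwd u e : walk src tgt u (tgt e) -> walk src tgt u (src e).

(* [gog_edge] is the set of geometric edges, each with a chosen orientation, so
   that there is a single edge group and a pair of monomorphisms per edge. *)
Record graph_of_groups := GraphOfGroups {
  gog_vertex : choiceType;
  gog_edge : choiceType;
  gog_src : gog_edge -> gog_vertex;
  gog_tgt : gog_edge -> gog_vertex;
  gog_connected : forall u v, walk gog_src gog_tgt u v;
  vertex_group : gog_vertex -> groupType;
  edge_group : gog_edge -> groupType;
  src_mono : forall e, {multiplicative edge_group e -> vertex_group (gog_src e)};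
  tgt_mono : forall e, {multiplicative edge_group e -> vertex_group (gog_tgt e)};
  src_mono_inj : forall e, injective (src_mono e);
  tgt_mono_inj : forall e, injective (tgt_mono e)
}.

Section FundamentalGroup.
Variable A : graph_of_groups.

Definition path_gen : choiceType :=
  ({v : gog_vertex A & vertex_group v} + gog_edge A)%type.

Definition vertex_letter (v : gog_vertex A) (g : vertex_group v) : path_gen :=
  inl (existT (fun v => vertex_group v) v g).
Definition edge_letter (e : gog_edge A) : path_gen := inr e.

Inductive path_rel : word path_gen -> word path_gen -> Prop :=
| PathVertex v (g h : vertex_group v) :
    path_rel [:: (vertex_letter g, false); (vertex_letter h, false)]
             [:: (vertex_letter (g * h)%g, false)]
| PathEdge e (c : edge_group e) :
    path_rel [:: (edge_letter e, false);
                 (vertex_letter (tgt_mono e c), false);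
                 (edge_letter e, true)]
             [:: (vertex_letter (src_mono e c), false)].

(* The Bass-Serre path group [F(A)], with [e c^tgt e^-1 = c^src]. *)
Definition path_group : groupType := presented path_rel.

Definition vertex_elt (v : gog_vertex A) (g : vertex_group v) : path_group :=
  pres_gen path_rel (vertex_letter g).
Definition edge_elt (e : gog_edge A) : path_group :=
  pres_gen path_rel (edge_letter e).

(* [path_elt u v x]: [x = g_0 e_1 g_1 ... e_n g_n] for an edge path
   [e_1 ... e_n] from [u] to [v] and elements [g_i] of the vertex groups along
   it. *)
Inductive path_elt (u : gog_vertex A) : gog_vertex A -> path_group -> Prop :=
| PathNil (g : vertex_group u) : path_elt u u (vertex_elt g)
| PathFwd e x (g : vertex_group (gog_tgt e)) :
    path_elt u (gog_src e) x ->
    path_elt u (gog_tgt e) (x * edge_elt e * vertex_elt g)%g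
| PathBwd e x (g : vertex_group (gog_src e)) :
    path_elt u (gog_tgt e) x ->
    path_elt u (gog_src e) (x * (edge_elt e)^-1 * vertex_elt g)%g.

Lemma vertex_eltM v (g h : vertex_group v) :
  vertex_elt (g * h)%g = (vertex_elt g * vertex_elt h)%g.
Proof.
rewrite /vertex_elt /pres_gen [RHS]pres_classM; apply/pres_classP/WordSym/WordRel.
exact: PathVertex.
Qed.

Lemma vertex_elt1 v : vertex_elt (1%g : vertex_group v) = 1%g.
Proof.
by apply: (mulgI (vertex_elt (1%g : vertex_group v))); rewrite -vertex_eltM !mulg1.
Qed.

Lemma vertex_eltV v (g : vertex_group v) : vertex_elt g^-1%g = (vertex_elt g)^-1%g.
Proof.
by apply: (mulgI (vertex_elt g)); rewrite -vertex_eltM !mulgV vertex_elt1.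
Qed.

Lemma path_eltM u v w x y :
  path_elt u v x -> path_elt v w y -> path_elt u w (x * y)%g.
Proof.
move=> px; elim=> [g|e {}y g _ IH|e {}y g _ IH].
- case: px g => [h|e {}x h px|e {}x h px] g.
  + by rewrite -vertex_eltM; apply: PathNil.
  + by rewrite -mulgA -vertex_eltM; apply: PathFwd.
  + by rewrite -mulgA -vertex_eltM; apply: PathBwd.
- by rewrite !mulgA; apply: PathFwd.
- by rewrite !mulgA; apply: PathBwd.
Qed.

Lemma path_eltV u v x : path_elt u v x -> path_elt v u x^-1%g.
Proof.
elim=> [g|e {}x g _ IH|e {}x g _ IH].
- by rewrite -vertex_eltV; apply: PathNil.
- rewrite !invgM mulgA; apply: path_eltM IH.
  rewrite -vertex_eltV -[X in path_elt _ _ X]mulg1 -(vertex_elt1 (gog_src e)).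
  by apply: PathBwd; apply: PathNil.
- rewrite !invgM mulgA; apply: path_eltM IH.
  rewrite -vertex_eltV invgK -[X in path_elt _ _ X]mulg1 -(vertex_elt1 (gog_tgt e)).
  by apply: PathFwd; apply: PathNil.
Qed.

Variable P : gog_vertex A.

Definition loop_pred : {pred path_group} := fun x => `[< path_elt P P x >].

Fact loop_closedM : mulg_closed loop_pred.
Proof.
move=> x y /asboolP px /asboolP py; apply/asboolP; exact: path_eltM px py.
Qed.
Fact loop_closed1 : 1%g \in loop_pred.
Proof. by apply/asboolP; rewrite -(vertex_elt1 P); apply: PathNil. Qed.
Fact loop_closedV : invg_closed loop_pred.
Proof. by move=> x /asboolP px; apply/asboolP; apply: path_eltV. Qed.

HB.instance Definition _ := isMulClosed.Build path_group loop_pred loop_closedM.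
HB.instance Definition _ := isMul1Closed.Build path_group loop_pred loop_closed1.
HB.instance Definition _ := isInvClosed.Build path_group loop_pred loop_closedV.

(* [pi_1(A, P)]: the elements of [F(A)] carried by closed edge paths at [P]. *)
Definition fundamental_group : groupType := @subgrp path_group loop_pred.

End FundamentalGroup.

(* [monalg] only makes [{malg R[K]}] a ring when [K] is a [monomType], in which
   1 is the only unit; for a group the product has to be defined here. *)
Section GroupRing.
Variables (R : nzRingType) (G : groupType).

Definition group_ring : Type := {malg R[G]}.

HB.instance Definition _ := GRing.Lmodule.on group_ring.

Implicit Types a b c : group_ring.

Definition gr_one : group_ring := << 1 *g (1%g : G) >>.

Definition gr_mul a b : group_ring :=
  \sum_(g <- msupp a) \sum_(h <- msupp b) << a@_g * b@_h *g (g * h)%g >>.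

Lemma gr_mulw (d1 d2 : {fset G}) a b :
  (msupp a `<=` d1)%fset -> (msupp b `<=` d2)%fset ->
  gr_mul a b = \sum_(g <- d1) \sum_(h <- d2) << a@_g * b@_h *g (g * h)%g >>.
Proof.
move=> le1 le2; rewrite /gr_mul (big_fset_incl _ le1) /=.
  apply/eq_bigr=> g _; apply/big_fset_incl => // h _ /mcoeff_outdom ->.
  by rewrite mulr0 monalgU0.
by move=> g _ /mcoeff_outdom ag; rewrite big1 // => h _; rewrite ag mul0r monalgU0.
Qed.

Fact gr_mulDl : left_distributive gr_mul +%R.
Proof.
move=> a b c.
rewrite (gr_mulw (msuppD_le _ _) (fsubset_refl (msupp c))).
rewrite (gr_mulw (fsubsetUl _ (msupp b)) (fsubset_refl (msupp c))).
rewrite (gr_mulw (fsubsetUr (msupp a) _) (fsubset_refl (msupp c))).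
rewrite -big_split; apply/eq_bigr=> g _.
rewrite -big_split; apply/eq_bigr=> h _.
by rewrite mcoeffD mulrDl monalgUD.
Qed.

Fact gr_mulDr : right_distributive gr_mul +%R.
Proof.
move=> c a b.
rewrite (gr_mulw (fsubset_refl (msupp c)) (msuppD_le _ _)).
rewrite (gr_mulw (fsubset_refl (msupp c)) (fsubsetUl _ (msupp b))).
rewrite (gr_mulw (fsubset_refl (msupp c)) (fsubsetUr (msupp a) _)).
rewrite -big_split; apply/eq_bigr=> g _.
rewrite -big_split; apply/eq_bigr=> h _.
by rewrite mcoeffD mulrDr monalgUD.
Qed.

Lemma gr_mul0 a : gr_mul 0 a = 0.
Proof. by rewrite /gr_mul msupp0 big_seq_fset0. Qed.

Lemma gr_mulr0 a : gr_mul a 0 = 0.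
Proof. by rewrite /gr_mul big1 // => g _; rewrite msupp0 big_seq_fset0. Qed.

Lemma gr_mulUU x y (g h : G) :
  gr_mul << x *g g >> << y *g h >> = << x * y *g (g * h)%g >>.
Proof. by rewrite (gr_mulw msuppU_le msuppU_le) !big_seq_fset1 !mcoeffUU. Qed.

Lemma gr_ind (Q : group_ring -> Prop) :
  (forall x g, Q << x *g g >>) -> (forall a b, Q a -> Q b -> Q (a + b)) ->
  forall a, Q a.
Proof.
move=> QU QD a; rewrite [a]monalgE; elim/big_ind: _ => //.
by rewrite -(monalgU0 (1%g : G)).
Qed.

Fact gr_mulA : associative gr_mul.
Proof.
move=> a b c; elim/gr_ind: a => [x g|a1 a2 IH1 IH2]; last first.
  by rewrite !gr_mulDl IH1 IH2.
elim/gr_ind: b => [y h|b1 b2 IH1 IH2]; last first.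
  by rewrite gr_mulDr !gr_mulDl gr_mulDr IH1 IH2.
elim/gr_ind: c => [z k|c1 c2 IH1 IH2]; last first.
  by rewrite !gr_mulDr IH1 IH2.
by rewrite !gr_mulUU mulrA mulgA.
Qed.

Fact gr_mul1 : left_id gr_one gr_mul.
Proof.
by elim/gr_ind => [x g|a b IHa IHb]; rewrite ?gr_mulUU ?mul1r ?mul1g // gr_mulDr IHa IHb.
Qed.

Fact gr_mulr1 : right_id gr_one gr_mul.
Proof.
by elim/gr_ind => [x g|a b IHa IHb]; rewrite ?gr_mulUU ?mulr1 ?mulg1 // gr_mulDl IHa IHb.
Qed.

Fact gr_one_neq0 : gr_one != 0.
Proof.
apply/eqP=> /(congr1 (fun a : {malg R[G]} => a@_(1%g))) /eqP.
by rewrite mcoeffUU mcoeff0 oner_eq0.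
Qed.

HB.instance Definition _ := GRing.Zmodule_isNzRing.Build group_ring
  gr_mulA gr_mul1 gr_mulr1 gr_mulDl gr_mulDr gr_one_neq0.

Definition augmentation a : R := \sum_(g <- msupp a) a@_g.

Lemma augmentationU x (g : G) : augmentation << x *g g >> = x.
Proof.
rewrite /augmentation (big_fset_incl _ (msuppU_le (k := g) (x := x))) /=.
  by rewrite big_seq_fset1 mcoeffUU.
by move=> h _ /mcoeff_outdom.
Qed.

Lemma augmentationD : {morph augmentation : a b / a + b}.
Proof.
move=> a b.
have auw (d : {fset G}) e : (msupp e `<=` d)%fset ->
    augmentation e = \sum_(g <- d) e@_g.
  by move=> le; apply/big_fset_incl => // g _ /mcoeff_outdom.
rewrite (auw _ _ (msuppD_le _ _)) (auw _ _ (fsubsetUl _ (msupp b))).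
rewrite (auw _ _ (fsubsetUr (msupp a) _)) -big_split.
by apply: eq_bigr => g _; rewrite mcoeffD.
Qed.

Lemma augmentationM : {morph augmentation : a b / a * b}.
Proof.
move=> a b; elim/gr_ind: a => [x g|a1 a2 IH1 IH2]; last first.
  by rewrite mulrDl !augmentationD mulrDl IH1 IH2.
elim/gr_ind: b => [y h|b1 b2 IH1 IH2]; last first.
  by rewrite mulrDr !augmentationD mulrDr IH1 IH2.
by rewrite [_ * _ : group_ring]gr_mulUU !augmentationU.
Qed.

End GroupRing.

Arguments augmentation {R G}.

Definition trivial_module (G : groupType) : Type := int.

Section TrivialModule.
Variable G : groupType.

HB.instance Definition _ := GRing.Zmodule.copy (trivial_module G) int.

Definition triv_scale (a : group_ring int G) (n : trivial_module G) :
  trivial_module G := (augmentation a : int) * (n : int).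

Fact triv_scaleA a b n : triv_scale a (triv_scale b n) = triv_scale (a * b) n.
Proof. by rewrite /triv_scale augmentationM mulrA. Qed.
Fact triv_scale1 : left_id 1 triv_scale.
Proof. by move=> n; rewrite /triv_scale augmentationU mul1r. Qed.
Fact triv_scaleDr : right_distributive triv_scale +%R.
Proof. by move=> a m n; rewrite /triv_scale mulrDr. Qed.
Fact triv_scaleDl n : {morph triv_scale^~ n : a b / a + b}.
Proof. by move=> a b; rewrite /triv_scale augmentationD mulrDl. Qed.

HB.instance Definition _ := GRing.Zmodule_isLmodule.Build (group_ring int G)
  (trivial_module G) triv_scaleA triv_scale1 triv_scaleDr triv_scaleDl.

End TrivialModule.

(* Modules are left modules throughout. *)
Definition fg_module (S : nzRingType) (M : lmodType S) : Prop :=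
  exists (n : nat) (e : 'I_n -> M),
    forall x : M, exists c : 'I_n -> S, x = \sum_(i < n) c i *: e i.

Definition projective_module (S : nzRingType) (P : lmodType S) : Prop :=
  forall (M N : lmodType S) (p : {linear M -> N}) (f : {linear P -> N}),
    (forall y : N, exists x : M, p x = y) ->
    exists h : {linear P -> M}, forall x : P, p (h x) = f x.

Definition type_FP (n : nat) (G : groupType) : Prop :=
  exists (P : nat -> lmodType (group_ring int G))
         (d : forall i, {linear P i.+1 -> P i})
         (eps : {linear P 0%N -> trivial_module G}),
    [/\ forall i, projective_module (P i),
        forall i x, d i x = 0 <-> exists y, d i.+1 y = x,
        forall x, eps x = 0 <-> exists y, d 0%N y = x,
        forall z, exists x, eps x = z
      & forall i, (i <= n)%N -> fg_module (P i)].

Definition almost_finitely_presented (G : groupType) : Prop := type_FP 2 G.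

Definition almost_coherent (G : groupType) : Prop :=
  forall H : groupClosed G,
    finitely_generated (subgrp H) -> almost_finitely_presented (subgrp H).

Section AnalyticZeroDivisor.
Variables (R : realType) (G : groupType).

Definition square_summable (b : G -> R[i]) : Prop :=
  (\esum_(g in [set: G]) ((ComplexField.Normc.normc (b g)) ^+ 2)%:E < +oo)%E.

(* For each [g] only finitely many [h] contribute to the sum, since [a] has
   finite support. *)
Definition l2_mul (a : group_ring R[i] G) (b : G -> R[i]) (g : G) : R[i] :=
  \sum_(h \in [set: G]) a@_(g * h^-1)%g * b h.

Definition analytic_zero_divisor_conjecture : Prop :=
  forall (a : group_ring R[i] G) (b : G -> R[i]),
    a <> 0 -> square_summable b -> (exists g, b g <> 0) ->
    exists g, l2_mul a b g <> 0.

End AnalyticZeroDivisor.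

(* Main.v *)
Require Import Defs.
From HB Require Import structures.
From mathcomp Require Import all_boot all_order all_algebra finmap.
From mathcomp Require Import monalg boolp classical_sets reals zify ring.
From mathcomp Require cardinality.

(** A group [H] acting on a tree yields an exact sequence of [Z[H]]-modules
      [0 -> Z[E] -> Z[V] -> Z -> 0],
    where [V] and [E] are the sets of vertices and of edges.  The Bass-Serre tree
    of a graph of groups has conjugates of the vertex groups and of the edge
    groups as stabilizers, and a subgroup acts on it with the intersections as
    stabilizers.  Suppose that [H] is finitely generated and that the edge
    stabilizers are cyclic.  The finitely many paths from a base vertex to its
    images under generators of [H] span an [H]-invariant subtree with finitely
    many orbits, for which both permutation modules are finite sums of modules
    [Z[H/K]], with [K] a stabilizer.  Two comparisons of generators and relations
    then give the result.
    - [fg_relations]: [Z] is finitely presented over [Z[H]] because [H] is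
      finitely generated, and [Z[E]] is because the edge stabilizers are cyclic;
      hence so is the extension [Z[V]].  This forces the vertex stabilizers to be
      finitely generated ([fg_stabilizer]).
    - [resolve_cokernel]: if the vertex stabilizers are moreover of type [FP_2],
      then so is the module [Z[V]], and its quotient [Z] by the finitely
      presented module [Z[E]] is of type [FP_2] as well, which says that [H] is.
    This is [forest_FP2].  It remains to see that finitely generated subgroups of
    the vertex groups are of type [FP_2].  Those of [Q] are cyclic.  Those of
    [BS(1, m)] are obtained from the same theorem, applied to the tree of cosets
    of [<a>], whose stabilizers are all cyclic ([BS1_subgroup_FP2]).

    Two facts on Bass-Serre trees are needed, and both are proved without normal
    forms.  The injectivity of the boundary map [Z[E] -> Z[V]] follows from a
    crossed homomorphism [D] from the path group to [Z[E]] that vanishes on the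
    vertex groups and sends each edge generator to the corresponding edge: it is
    defined by its values on generators, and [x G_v |-> D x] inverts the boundary
    ([coset_forest_FP2], [path_derivation]).  The injectivity of the vertex groups
    into the path group ([vertex_elt_inj]) holds because these groups are
    countable: they all act freely on [nat] with infinitely many orbits, any two
    such actions of an edge group are isomorphic, and so the edge generators can
    be made to act too. *)

Set Implicit Arguments.
Unset Strict Implicit.
Unset Printing Implicit Defensive.

Import GRing.Theory.

Local Open Scope ring_scope.

(** * Linear extension from a basis *)

Lemma subrACA (V : zmodType) (a b c d : V) : (a - b) - (c - d) = (a - c) - (b - d).
Proof. by rewrite !opprB [X in _ + X]addrC addrACA [X in _ + X]addrC. Qed.

Section LinearExtension.
Variables (R : nzRingType) (K : choiceType) (M : lmodType R).

Definition lext (f : K -> M) (a : {malg R[K]}) : M :=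
  \sum_(k <- msupp a) a@_k *: f k.

Lemma lextw f a (d : {fset K}) :
  (msupp a `<=` d)%fset -> lext f a = \sum_(k <- d) a@_k *: f k.
Proof.
move=> le; apply/big_fset_incl => // k _ /mcoeff_outdom ->.
by rewrite scale0r.
Qed.

Fact lext_is_linear f : linear (lext f).
Proof.
move=> c a b; have le : (msupp (c *: a + b) `<=` msupp a `|` msupp b)%fset.
  by apply: fsubset_trans (msuppD_le _ _) _; apply/fsetSU/msuppZ_le.
rewrite (lextw f le) (lextw f (fsubsetUl _ (msupp b))).
rewrite (lextw f (fsubsetUr (msupp a) _)) scaler_sumr -big_split /=.
by apply: eq_bigr => k _; rewrite mcoeffD mcoeffZ scalerDl scalerA.
Qed.

HB.instance Definition _ f :=
  GRing.isLinear.Build R {malg R[K]} M _ (lext f) (lext_is_linear f).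

Lemma lextU f k : lext f << k >> = f k.
Proof. by rewrite (lextw f msuppU_le) big_seq_fset1 mcoeffUU scale1r. Qed.

Lemma malgU_Z (c : R) (k : K) : << c *g k >> = c *: << k >>.
Proof. by apply/malgP => j; rewrite mcoeffZ !mcoeffU mulr_natr. Qed.

Lemma lext_id : forall a : {malg R[K]}, a = \sum_(k <- msupp a) a@_k *: << k >>.
Proof. by move=> a; rewrite {1}[a]monalgE; apply: eq_bigr => k _; rewrite malgU_Z. Qed.

End LinearExtension.

Lemma malgE_int (K : choiceType) (a : {malg int[K]}) :
  a = \sum_(k <- msupp a) << k >> *~ a@_k.
Proof.
rewrite {1}[a]monalgE; apply: eq_bigr => k _.
by rewrite malgU_Z -scaler_int intz.
Qed.

Lemma malg_int_ind (K : choiceType) (Q : {malg int[K]} -> Prop) :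
  Q 0 -> (forall a b, Q a -> Q b -> Q (a - b)) -> (forall k, Q << k >>) ->
  forall a, Q a.
Proof.
move=> Q0 QB QU a.
have QN b : Q b -> Q (- b) by rewrite -(sub0r b); apply: QB.
have QD b c : Q b -> Q c -> Q (b + c) by rewrite -{2}[c]opprK; move=> ? /QN; apply: QB.
have Qn b n : Q b -> Q (b *+ n).
  by move=> Qb; elim: n => [|n IHn]; rewrite ?mulr0n // mulrS; apply: QD.
rewrite (malgE_int a); elim/big_ind: _ => // k _.
by case: (a@_k) => n; rewrite /intmul; [|apply: QN]; apply: Qn.
Qed.

(** Only the values on the support of [a] matter, which lets a finite
    decomposition be checked on one basis element at a time. *)
Lemma malg_int_ext (K : choiceType) (M : zmodType)
    (f g : {additive {malg int[K]} -> M}) (a : {malg int[K]}) :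
  (forall k, k \in msupp a -> f << k >> = g << k >>) -> f a = g a.
Proof.
move=> fg; rewrite (malgE_int a) !raddf_sum; apply: eq_big_seq => k /fg fgk.
by rewrite !raddfMz fgk.
Qed.

(** * Resolutions by free modules *)

Section FreeModules.
Variable S : nzRingType.

Lemma projective_rV n : projective_module ('rV[S]_n : lmodType S).
Proof.
move=> M N p f psurj.
have /choice [y yP] : forall i : 'I_n, exists y, p y = f (delta_mx 0 i).
  by move=> i; apply: psurj.
pose h (c : 'rV[S]_n) : M := \sum_i c 0 i *: y i.
have h_lin : linear h.
  move=> a u v; rewrite /h scaler_sumr -big_split; apply: eq_bigr => i _ /=.
  by rewrite !mxE scalerDl scalerA.
pose hL : {linear 'rV[S]_n -> M} := HB.pack h (GRing.isLinear.Build _ _ _ _ h h_lin).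
exists hL => c; rewrite {2}(row_sum_delta c) !linear_sum.
by apply: eq_bigr => i _; rewrite !linearZ /= yP.
Qed.

(** The basis may be infinite: such modules continue a resolution beyond the
    degrees in which finiteness is required. *)
Lemma projective_malg (K : choiceType) :
  projective_module ({malg S[K]} : lmodType S).
Proof.
move=> M N p f psurj.
have /choice [y yP] : forall k : K, exists y, p y = f << k >>.
  by move=> k; apply: psurj.
exists (lext y) => a; rewrite {2}(lext_id a) !linear_sum.
by apply: eq_bigr => k _; rewrite !linearZ /= yP.
Qed.

Lemma fg_rV n : fg_module ('rV[S]_n : lmodType S).
Proof.
exists n, (fun i => delta_mx 0 i) => x; exists (fun i => x 0 i).
exact: row_sum_delta.
Qed.

(** Bundling the two modules with the map makes a resolution the orbit of a
    single state under iteration. *)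
Record map_step := MapStep {
  ms_src : lmodType S;
  ms_tgt : lmodType S;
  ms_map : {linear ms_src -> ms_tgt}
}.

(** The next step covers the kernel of the given map by the free module on all
    elements of that kernel, so that exactness needs no finiteness. *)
Definition kernel_cover (s : map_step) : map_step :=
  MapStep (lext (val : {x : ms_src s | ms_map s x == 0} -> ms_src s)).

Lemma kernel_coverP (s : map_step) x :
  ms_map s x = 0 <-> exists y, ms_map (kernel_cover s) y = x.
Proof.
split=> [/eqP sx|[y <-]] /=.
  exists << (exist _ x sx : {x : ms_src s | ms_map s x == 0}) >>.
  exact: lextU.
rewrite /lext linear_sum big1 // => k _.
by rewrite linearZ /= (eqP (valP k)) scaler0.
Qed.

End FreeModules.

Section FinitePartialResolution.
Variable G : groupType.
Local Notation S := (group_ring int G).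

Definition augv n (c : 'rV[S]_n) : int := \sum_i augmentation (c 0 i).

(** [G] has a partial resolution of the trivial module by free modules of
    finite rank in degrees 0, 1, 2, in which all the basis elements of degree 0
    map to 1; matrices act on row vectors from the right because modules are
    left modules. *)
Definition free_FP2 : Prop :=
  exists (p q r : nat) (A : 'M[S]_(q, p)) (B : 'M[S]_(r, q)),
  [/\ (0 < p)%N,
      forall c : 'rV_p, augv c = 0 <-> exists d, c = d *m A
    & forall d : 'rV_q, d *m A = 0 <-> exists f, d = f *m B].

Lemma augmentation0 : augmentation (0 : S) = 0.
Proof. by apply: (addrI (augmentation (0 : S))); rewrite -augmentationD !addr0. Qed.

Lemma augv_is_linear n (a : S) (u v : 'rV[S]_n) :
  augv (a *: u + v) = augmentation a * augv u + augv v.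
Proof.
rewrite /augv mulr_sumr -big_split; apply: eq_bigr => i _ /=.
by rewrite !mxE augmentationD augmentationM.
Qed.

Lemma augv_delta n (i : 'I_n) : augv (delta_mx 0 i) = 1.
Proof.
rewrite /augv (bigD1 i) //= big1 ?addr0 => [|j /negPf ji].
  by rewrite mxE !eqxx augmentationU.
by rewrite mxE ji andbF augmentation0.
Qed.

(** Above degree 2 the resolution is continued by covers of kernels. *)
Lemma free_FP2_type_FP : free_FP2 -> type_FP 2 G.
Proof.
move=> [p [q [r [A [B [p0 exA exB]]]]]].
pose s0 : map_step S := MapStep (@mulmxr S 1 _ _ A : {linear 'rV_q -> 'rV_p}).
pose s1 : map_step S := MapStep (@mulmxr S 1 _ _ B : {linear 'rV_r -> 'rV_q}).
pose st n := if n is m.+1 then iter m (@kernel_cover S) s1 else s0.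
pose P n := ms_tgt (st n).
pose d n : {linear P n.+1 -> P n} :=
  match n return {linear P n.+1 -> P n} with
  | 0 => ms_map s0 | m.+1 => ms_map (iter m (@kernel_cover S) s1) end.
have aug_lin : linear (@augv p : 'rV[S]_p -> trivial_module G).
  by move=> a u v; rewrite augv_is_linear.
pose eps : {linear 'rV_p -> trivial_module G} :=
  HB.pack (@augv p : 'rV[S]_p -> trivial_module G)
    (GRing.isLinear.Build _ _ _ _ _ aug_lin).
exists P, d, eps; split.
- case=> [|[|[|n]]]; [exact: projective_rV|exact: projective_rV| |].
    exact: projective_rV.
  exact: projective_malg.
- case=> [|n] x; last exact: kernel_coverP.
  by rewrite /= exB; split=> -[y yx]; exists y.
- by move=> x; rewrite /= exA; split=> -[y yx]; exists y.
- move=> z; exists ((<< (z : int) *g (1%g : G) >> : S) *: delta_mx 0 (Ordinal p0)).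
  have := augv_is_linear (<< (z : int) *g (1%g : G) >> : S) (delta_mx 0 (Ordinal p0)) 0.
  rewrite addr0 /= => ->; rewrite augv_delta augmentationU mulr1.
  by rewrite /augv big1 ?addr0 // => i _; rewrite mxE augmentation0.
- by case=> [|[|[|//]]] _; exact: fg_rV.
Qed.

End FinitePartialResolution.

(** * Group rings of a group and of its subgroups *)

Section MultiplicativeGroupMaps.
Variables (G H : groupType) (f : {multiplicative G -> H}).

Lemma gmorph1 : f 1%g = 1%g.
Proof. by apply: (mulgI (f 1%g)); rewrite -gmulfM !mulg1. Qed.

Lemma gmorphV x : f x^-1%g = (f x)^-1%g.
Proof. by apply: (mulgI (f x)); rewrite -gmulfM !mulgV gmorph1. Qed.

End MultiplicativeGroupMaps.

Definition gel (G : groupType) (g : G) : group_ring int G := << 1 *g g >>.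

Lemma gelM (G : groupType) (g h : G) : gel (g * h)%g = gel g * gel h.
Proof. by rewrite [RHS]gr_mulUU mulr1. Qed.

Lemma gel1 (G : groupType) : gel (1%g : G) = 1.
Proof. by []. Qed.

Lemma augmentation_gel (G : groupType) (g : G) : augmentation (gel g) = 1.
Proof. exact: augmentationU. Qed.

Fact augmentationB (G : groupType) :
  zmod_morphism (@augmentation int G).
Proof.
move=> a b; apply: (addIr (augmentation b)).
by rewrite -augmentationD !subrK.
Qed.

HB.instance Definition _ (G : groupType) :=
  GRing.isZmodMorphism.Build (group_ring int G) int augmentation
    (@augmentationB G).

Lemma gr_int_ind (G : groupType) (Q : group_ring int G -> Prop) :
  Q 0 -> (forall a b, Q a -> Q b -> Q (a - b)) -> (forall g, Q (gel g)) ->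
  forall a, Q a.
Proof. exact: malg_int_ind. Qed.

Lemma coef_mul_gel (G : groupType) (a : group_ring int G) (g h : G) :
  (a * gel g)@_h = a@_(h * g^-1)%g.
Proof.
elim/gr_int_ind: a => [|a b IHa IHb|k]; first by rewrite mul0r !mcoeff0.
  by rewrite mulrBl !mcoeffB IHa IHb.
rewrite -gelM !mcoeffU; congr (_ *+ nat_of_bool _).
by apply/eqP/eqP => [<-|->]; rewrite ?mulgK ?mulgVK.
Qed.

Section GroupRingMap.
Variables (K H : groupType) (phi : {multiplicative K -> H}).
Local Notation ZK := (group_ring int K).
Local Notation ZH := (group_ring int H).

Definition grmap (a : ZK) : ZH := lext (fun k => gel (phi k)) a.

Fact grmapB : zmod_morphism grmap.
Proof. exact: raddfB. Qed.

HB.instance Definition _ :=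
  GRing.isZmodMorphism.Build ZK ZH grmap grmapB.

Lemma grmap_gel k : grmap (gel k) = gel (phi k).
Proof. exact: lextU. Qed.

Fact grmap_monoid_morphism : monoid_morphism grmap.
Proof.
split=> [|a b]; first by rewrite -gel1 grmap_gel gmorph1.
elim/gr_int_ind: a => [|a a' IH IH'|k]; first by rewrite mul0r !raddf0 mul0r.
  by rewrite mulrBl !grmapB IH IH' mulrBl.
elim/gr_int_ind: b => [|b b' IH IH'|l]; first by rewrite mulr0 !raddf0 mulr0.
  by rewrite mulrBr !grmapB IH IH' mulrBr.
by rewrite -gelM !grmap_gel -gelM gmulfM.
Qed.

HB.instance Definition _ :=
  GRing.isMonoidMorphism.Build ZK ZH grmap grmap_monoid_morphism.

End GroupRingMap.

(** [Z[H]] is a free right module over [Z[K]] for a subgroup [K], with basis a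
    left transversal: [slice t] is the coordinate on the coset of [t]. *)
Section CosetSlices.
Variables (K H : groupType) (phi : {multiplicative K -> H}).
Hypothesis phi_inj : injective phi.
Local Notation ZK := (group_ring int K).
Local Notation ZH := (group_ring int H).

Definition in_lcoset (t h : H) : Prop := exists k, h = (t * phi k)%g.

Lemma lcoset_refl t : in_lcoset t t.
Proof. by exists 1%g; rewrite gmorph1 mulg1. Qed.

Lemma lcoset_trans t u v : in_lcoset t u -> in_lcoset u v -> in_lcoset t v.
Proof. by case=> k -> [l ->]; exists (k * l)%g; rewrite gmulfM mulgA. Qed.

Lemma lcoset_sym t u : in_lcoset t u -> in_lcoset u t.
Proof. by case=> k ->; exists k^-1%g; rewrite -mulgA -gmulfM mulgV gmorph1 mulg1. Qed.

Definition lcoset_repr (h : H) : H := choose (fun t => `[< in_lcoset t h >]) h.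

Lemma lcoset_reprP h : in_lcoset (lcoset_repr h) h.
Proof. by apply/asboolP/(@chooseP _ (fun t => `[< in_lcoset t h >]))/asboolP/lcoset_refl. Qed.

Lemma eq_lcoset_repr t h : in_lcoset t h -> lcoset_repr t = lcoset_repr h.
Proof.
move=> th; rewrite /lcoset_repr (eq_choose (Q := fun u => `[< in_lcoset u h >])).
  by apply: choose_id; apply/asboolP => //; apply: lcoset_refl.
move=> u; apply/asboolP/asboolP => ut; first exact: lcoset_trans ut th.
exact: lcoset_trans ut (lcoset_sym th).
Qed.

Definition slice (t : H) (a : ZH) : ZK :=
  lext (fun h => if pselect (in_lcoset t h) is left e
                 then gel (projT1 (cid e)) else 0) a.

Fact sliceB t : zmod_morphism (slice t).
Proof. exact: raddfB. Qed.

HB.instance Definition _ t :=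
  GRing.isZmodMorphism.Build ZH ZK (slice t) (sliceB t).

Lemma slice_gel t k : slice t (gel (t * phi k)%g) = gel k.
Proof.
rewrite [LHS]lextU; case: pselect => [e|[]]; last by exists k.
by congr gel; case: (cid e) => l /= /mulgI /phi_inj.
Qed.

Lemma slice_gel0 t h : ~ in_lcoset t h -> slice t (gel h) = 0.
Proof. by move=> nth; rewrite [LHS]lextU; case: pselect. Qed.

Lemma slice_mul t (a : ZH) (b : ZK) : slice t (a * grmap phi b) = slice t a * b.
Proof.
elim/gr_int_ind: a => [|a a' IH IH'|h]; first by rewrite mul0r raddf0 mul0r.
  by rewrite mulrBl !sliceB IH IH' mulrBl.
elim/gr_int_ind: b => [|b b' IH IH'|k]; first by rewrite raddf0 !mulr0 raddf0.
  by rewrite grmapB !mulrBr sliceB IH IH'.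
rewrite grmap_gel -gelM; have [[l ->]|nth] := pselect (in_lcoset t h).
  by rewrite -mulgA -gmulfM !slice_gel gelM.
rewrite !slice_gel0 ?mul0r // => /lcoset_trans thk; apply/nth/thk.
by apply: lcoset_sym; exists k.
Qed.

Lemma slice_sum (a : ZH) (T : {fset H}) :
  (forall h, h \in msupp a -> lcoset_repr h \in T) ->
  (forall t, t \in T -> lcoset_repr t = t) ->
  a = \sum_(t <- T) gel t * grmap phi (slice t a).
Proof.
move=> aT Tr; pose F (b : ZH) : ZH := \sum_(t <- T) gel t * grmap phi (slice t b).
have F_zmod : zmod_morphism F.
  move=> b c; rewrite /F -sumrB; apply: eq_bigr => t _.
  by rewrite sliceB grmapB mulrBr.
pose FL : {additive ZH -> ZH} := HB.pack F (GRing.isZmodMorphism.Build _ _ F F_zmod).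
apply: (malg_int_ext (f := idfun) (g := FL)) => h /aT hT; rewrite /= /F.
rewrite (big_fsetD1 _ hT) /= big1_fset => [|t]; last first.
  rewrite !inE => /andP[tN tT] _; rewrite -/(gel h) slice_gel0 ?raddf0 ?mulr0 //.
  by move=> /eq_lcoset_repr th; case/negP: tN; rewrite -th Tr.
rewrite addr0 -/(gel h); have := lcoset_reprP h.
by move: (lcoset_repr h) => t [k ->]; rewrite slice_gel grmap_gel -gelM.
Qed.

End CosetSlices.

(** * Permutation modules *)

Record gset (H : groupType) := GSet {
  gs_sort :> choiceType;
  gs_act : H -> gs_sort -> gs_sort;
  gs_act1 : forall x, gs_act 1%g x = x;
  gs_actM : forall g h x, gs_act (g * h)%g x = gs_act g (gs_act h x)
}.

Section PermutationModules.
Variables (H : groupType) (X : gset H).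
Local Notation ZH := (group_ring int H).
Local Notation act := (@gs_act H X).

Lemma gs_actK h : cancel (act h) (act h^-1%g).
Proof. by move=> x; rewrite -gs_actM mulVg gs_act1. Qed.

Definition translate (h : H) (m : {malg int[X]}) : {malg int[X]} :=
  lext (fun x => << act h x >>) m.

Fact translateB h : zmod_morphism (translate h).
Proof. exact: raddfB. Qed.

HB.instance Definition _ h :=
  GRing.isZmodMorphism.Build _ _ (translate h) (translateB h).

Lemma translateU h x : translate h << x >> = << act h x >>.
Proof. exact: lextU. Qed.

Lemma translate0 h : translate h 0 = 0.
Proof. exact: raddf0. Qed.

Lemma translateN h m : translate h (- m) = - translate h m.
Proof. exact: raddfN. Qed.

Lemma translate1 m : translate 1%g m = m.
Proof.
elim/malg_int_ind: m => [|a b IHa IHb|x]; first by rewrite raddf0.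
  by rewrite translateB IHa IHb.
by rewrite translateU gs_act1.
Qed.

Lemma translateM g h m : translate (g * h)%g m = translate g (translate h m).
Proof.
elim/malg_int_ind: m => [|a b IHa IHb|x]; first by rewrite !raddf0.
  by rewrite !translateB IHa IHb.
by rewrite !translateU gs_actM.
Qed.

(** The [Z[H]]-linear map from [Z[H]] to [Z[X]] that sends [1] to [x]. *)
Definition orb (x : X) (c : ZH) : {malg int[X]} := lext (fun h => << act h x >>) c.

Fact orbB x : zmod_morphism (orb x).
Proof. exact: raddfB. Qed.

HB.instance Definition _ x :=
  GRing.isZmodMorphism.Build ZH {malg int[X]} (orb x) (orbB x).

Lemma orb_gel x h : orb x (gel h) = << act h x >>.
Proof. exact: lextU. Qed.

Lemma orb_gelM x h c : orb x (gel h * c) = translate h (orb x c).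
Proof.
elim/gr_int_ind: c => [|a b IHa IHb|g]; first by rewrite mulr0 !raddf0.
  by rewrite mulrBr !orbB translateB IHa IHb.
by rewrite -gelM !orb_gel translateU gs_actM.
Qed.

Lemma coef_orb_notin x c y : (forall h, act h x <> y) -> (orb x c)@_y = 0.
Proof.
move=> xy; elim/gr_int_ind: c => [|a b IHa IHb|g].
- by rewrite raddf0 mcoeff0.
- by rewrite orbB mcoeffB IHa IHb.
by rewrite orb_gel mcoeffU; case: eqP => // /xy.
Qed.

(** A row vector over [Z[H]] is a relation among the [b i] exactly when [orbv b]
    kills it. *)
Definition orbv n (b : 'I_n -> X) (c : 'rV[ZH]_n) : {malg int[X]} :=
  \sum_i orb (b i) (c 0 i).

Fact orbvB n (b : 'I_n -> X) : zmod_morphism (orbv b).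
Proof.
move=> c d; rewrite /orbv -sumrB; apply: eq_bigr => i _.
by rewrite !mxE orbB.
Qed.

HB.instance Definition _ n (b : 'I_n -> X) :=
  GRing.isZmodMorphism.Build _ _ (orbv b) (orbvB b).

Lemma orbv_gelZ n (b : 'I_n -> X) h c : orbv b (gel h *: c) = translate h (orbv b c).
Proof.
by rewrite /orbv raddf_sum; apply: eq_bigr => i _; rewrite mxE orb_gelM.
Qed.

Lemma orbvZ_eq0 n (b : 'I_n -> X) a c : orbv b c = 0 -> orbv b (a *: c) = 0.
Proof.
move=> bc; elim/gr_int_ind: a => [|a a' IH IH'|h]; first by rewrite scale0r raddf0.
  by rewrite scalerBl orbvB IH IH' subr0.
by rewrite orbv_gelZ bc raddf0.
Qed.

Lemma orbv_delta n (b : 'I_n -> X) i a : orbv b (a *: delta_mx 0 i) = orb (b i) a.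
Proof.
rewrite /orbv (bigD1 i) //= big1 ?addr0 => [|j /negPf ji].
  by rewrite !mxE !eqxx mulr1.
by rewrite !mxE ji andbF mulr0 raddf0.
Qed.

(** The submodule of [Z[X]] spanned by the orbits of the family [b] has a
    partial resolution by finite free modules with [b] as first generators. *)
Definition span_FP2 n (b : 'I_n -> X) : Prop :=
  exists q r (A : 'M[ZH]_(q, n)) (B : 'M[ZH]_(r, q)),
    (forall c : 'rV_n, orbv b c = 0 <-> exists d, c = d *m A) /\
    (forall d : 'rV_q, d *m A = 0 <-> exists f, d = f *m B).

End PermutationModules.

Section OrbitModule.
Variables (H : groupType) (X : gset H) (x : X).
Variables (K : groupType) (phi : {multiplicative K -> H}).
Hypothesis phi_inj : injective phi.
Hypothesis stabP : forall h, gs_act h x = x <-> exists k, h = phi k.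
Local Notation ZK := (group_ring int K).
Local Notation ZH := (group_ring int H).

Lemma coef_orb t c : (orb x c)@_(gs_act t x) = augmentation (slice phi t c).
Proof.
elim/gr_int_ind: c => [|a b IHa IHb|h]; first by rewrite !raddf0.
  by rewrite orbB mcoeffB IHa IHb sliceB augmentationB.
rewrite orb_gel mcoeffU; have [[k ->]|nth] := pselect (in_lcoset phi t h).
  rewrite slice_gel // augmentation_gel gs_actM.
  by have -> : gs_act (phi k) x = x; [apply/stabP; exists k | rewrite eqxx].
rewrite slice_gel0 // raddf0; case: eqP => // hx; case: nth.
have /stabP[k tk] : gs_act (t^-1 * h)%g x = x by rewrite gs_actM hx gs_actK.
by exists k; rewrite -tk mulVKg.
Qed.

(** The module spanned by the orbit of [x] is induced from the trivial module of
    the stabilizer, so a relation is tested on each coset separately. *)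
Lemma orb_eq0 c : orb x c = 0 <-> forall t, augmentation (slice phi t c) = 0.
Proof.
split=> [xc t|tc]; first by rewrite -coef_orb xc mcoeff0.
apply/malgP => y; rewrite mcoeff0.
have [[t <-]|ny] := pselect (exists t, gs_act t x = y); first by rewrite coef_orb.
by apply: coef_orb_notin => t ty; apply: ny; exists t.
Qed.

Lemma slice_mulmx t n m (c : 'rV[ZH]_n) (A : 'M[ZK]_(n, m)) :
  map_mx (slice phi t) (c *m map_mx (grmap phi) A) = map_mx (slice phi t) c *m A.
Proof.
apply/matrixP => i j; rewrite !mxE raddf_sum; apply: eq_bigr => k _.
by rewrite !mxE /= slice_mul.
Qed.

(** Since [Z[H]] is a direct sum of copies of [Z[K]], one for each coset, a
    system of linear equations over [Z[K]] may be solved coset by coset. *)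
Lemma slice_descent n m (c : 'rV[ZH]_n) (B : 'M[ZK]_(m, n)) :
  (forall t, exists f, map_mx (slice phi t) c = f *m B) ->
  exists f, c = f *m map_mx (grmap phi) B.
Proof.
move=> /choice[f fP].
pose T : {fset H} := [fset h in [seq lcoset_repr phi h | i <- enum 'I_n, h <- msupp (c 0 i)]]%fset.
exists (\sum_(t <- T) gel t *: map_mx (grmap phi) (f t)).
apply/rowP => i; rewrite mulmx_suml summxE.
rewrite (@slice_sum _ _ _ phi_inj (c 0 i) T).
- apply: eq_bigr => t _; rewrite -scalemxAl mxE; congr (_ * _).
  by rewrite -map_mxM -fP !mxE.
- move=> h hc; rewrite !inE; apply/allpairsPdep; exists i, h.
  by rewrite mem_enum.
move=> t; rewrite !inE => /allpairsPdep[j [h [_ _ ->]]].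
by apply/esym/eq_lcoset_repr/lcoset_sym/lcoset_reprP.
Qed.

(** Inducing a partial resolution of [Z] over [Z[K]] up to [Z[H]] keeps it exact,
    and resolves the module spanned by the orbit of [x]. *)
Lemma orbit_FP2 : free_FP2 K ->
  exists n (b : 'I_n -> X), [/\ (0 < n)%N, forall i, b i = x & span_FP2 b].
Proof.
move=> [p [q [r [A [B [p0 exA exB]]]]]].
exists p, (fun=> x); split=> //.
exists q, r, (map_mx (grmap phi) A), (map_mx (grmap phi) B).
have sl_eq0 m (d : 'rV[ZH]_m) :
    (forall t, map_mx (slice phi t) d = 0) -> d = 0.
  move=> d0; have [t|f ->] := @slice_descent _ 0 d 0.
    by exists 0; rewrite d0 mul0mx.
  by rewrite map_mx0 mulmx0.
have orbvE (c : 'rV[ZH]_p) : orbv (fun=> x) c = orb x (\sum_i c 0 i).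
  by rewrite raddf_sum.
have augvE t (c : 'rV[ZH]_p) :
    augmentation (slice phi t (\sum_i c 0 i)) = augv (map_mx (slice phi t) c).
  rewrite (raddf_sum (slice phi t)) (raddf_sum augmentation).
  by apply: eq_bigr => i _; rewrite mxE.
split=> [c|d].
  rewrite orbvE orb_eq0; split=> [tc|[d ->] t].
    by apply: slice_descent => t; apply/exA; rewrite -augvE.
  by rewrite augvE; apply/exA; exists (map_mx (slice phi t) d); rewrite slice_mulmx.
split=> [dA|[f ->]].
  by apply: slice_descent => t; apply/exB; rewrite -slice_mulmx dA map_mx0.
apply: sl_eq0 => t; rewrite !slice_mulmx; apply/exB.
by exists (map_mx (slice phi t) f).
Qed.

End OrbitModule.

(** * Relations of extensions and of cokernels *)

Section RowSpans.
Variable S : nzRingType.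

Definition in_rows m n (A : 'M[S]_(m, n)) (c : 'rV_n) := exists d, c = d *m A.

Lemma in_rows_all m k n (M : 'M[S]_(m, n)) (A : 'M_(k, n)) :
  (forall i, in_rows A (row i M)) -> exists D, M = D *m A.
Proof.
move=> /choice[f fP]; exists (\matrix_i f i).
by apply/row_matrixP => i; rewrite row_mul rowK.
Qed.

(** With [RB] and [RA] the row spans of [R] and [Y], [RC] is the module of
    relations of a quotient [B/A]: [beta] writes the generators of [A] in terms
    of those of [B], and the last hypothesis says that [A] embeds in [B].  The
    matrices obtained form the mapping cone of the inclusion of [A]. *)
Lemma resolve_cokernel q p y u w (Y : 'M[S]_(y, q)) (R : 'M_(u, p))
    (Z : 'M_(w, u)) (beta : 'M_(q, p)) (RC : 'rV_p -> Prop) :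
  (forall d : 'rV_u, d *m R = 0 <-> in_rows Z d) ->
  (forall c, RC c <-> exists mu, in_rows R (c - mu *m beta)) ->
  (forall mu, in_rows R (mu *m beta) <-> in_rows Y mu) ->
  exists q' r' (A : 'M_(q', p)) (B : 'M_(r', q')),
    (forall c, RC c <-> in_rows A c) /\
    (forall d : 'rV_q', d *m A = 0 <-> in_rows B d).
Proof.
move=> exR RCP betaP.
have [rho rhoP] : exists rho, Y *m beta = rho *m R.
  apply: in_rows_all => i; rewrite row_mul; apply/betaP.
  by exists (delta_mx 0 i); rewrite -rowE.
exists (u + q)%N, (w + y)%N, (col_mx R beta), (block_mx Z 0 (- rho) Y).
split=> [c|d].
  rewrite RCP; split=> [[mu [d dP]]|[d ->]].
    by exists (row_mx d mu); rewrite mul_row_col -dP subrK.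
  rewrite -[d]hsubmxK mul_row_col; exists (rsubmx d), (lsubmx d).
  by rewrite addrK.
split=> [|[f ->]].
  rewrite -[d]hsubmxK mul_row_col; set l := lsubmx d; set mu := rsubmx d => lmu.
  have [nu nuP] : in_rows Y mu.
    apply/betaP; exists (- l); rewrite mulNmx; apply/eqP.
    by rewrite -addr_eq0 addrC lmu.
  have [z zP] : in_rows Z (l + nu *m rho).
    by apply/exR; rewrite mulmxDl -mulmxA -rhoP mulmxA -nuP.
  exists (row_mx z nu); rewrite mul_row_block mulmx0 add0r -nuP.
  by rewrite mulmxN -zP addrK.
rewrite -[f]hsubmxK mul_row_block mulmx0 add0r mul_row_col.
rewrite mulmxDl mulmxN mulNmx -!mulmxA rhoP subrK mulmxA.
by apply/exR; exists (lsubmx f).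
Qed.

(** In an exact sequence [0 -> A -> B -> C -> 0], with [RB], the rows of [Y] and
    those of [W] giving the relations of [B], [A] and [C]: each relation of [C]
    can be corrected by generators of [A] to a relation of [B], and what is left
    is a relation of [A]. *)
Lemma fg_relations q p y m (Y : 'M[S]_(y, q)) (W : 'M_(m, p))
    (beta : 'M_(q, p)) (RB : 'rV_p -> Prop) :
  RB 0 -> (forall c d, RB c -> RB d -> RB (c - d)) ->
  (forall a c, RB c -> RB (a *: c)) ->
  (forall c, in_rows W c <-> exists mu, RB (c - mu *m beta)) ->
  (forall mu, RB (mu *m beta) <-> in_rows Y mu) ->
  exists k (R : 'M_(k, p)), forall c, RB c <-> in_rows R c.
Proof.
move=> RB0 RBB RBZ WP betaP.
have RBD c d : RB c -> RB d -> RB (c + d).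
  by move=> RBc RBd; rewrite -[d]opprK; apply: (RBB) => //; rewrite -sub0r; apply: RBB.
have RBmul k (M : 'M_(k, p)) : (forall i, RB (row i M)) -> forall c, RB (c *m M).
  move=> RBM c; rewrite mulmx_sum_row; elim/big_ind: _ => // i _.
  exact: RBZ.
have [D DP] : exists D, forall i, RB (row i (W - D *m beta)).
  have /choice[f fP] : forall i, exists mu, RB (row i W - mu *m beta).
    by move=> i; apply/WP; exists (delta_mx 0 i); rewrite -rowE.
  by exists (\matrix_i f i) => i; rewrite linearB /= row_mul rowK.
exists (m + y)%N, (col_mx (W - D *m beta) (Y *m beta)) => c; split=> [RBc|[d ->]].
  have [l lP] : in_rows W c by apply/WP; exists 0; rewrite mul0mx subr0.
  have [nu nuP] : in_rows Y (l *m D).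
    apply/betaP; rewrite -mulmxA.
    have -> : l *m (D *m beta) = c - l *m (W - D *m beta).
      by rewrite mulmxBr -lP opprB addrC subrK.
    by apply: RBB => //; apply: RBmul.
  exists (row_mx l nu); rewrite mul_row_col mulmxBr -lP !mulmxA -nuP.
  by rewrite subrK.
rewrite -[d]hsubmxK mul_row_col; apply: RBD; first exact: RBmul.
by rewrite mulmxA; apply/betaP; exists (rsubmx d).
Qed.

Lemma in_rowsB m n (A : 'M[S]_(m, n)) c d :
  in_rows A c -> in_rows A d -> in_rows A (c - d).
Proof. by move=> [u ->] [v ->]; exists (u - v); rewrite mulmxBl. Qed.

Lemma in_rowsZ m n (A : 'M[S]_(m, n)) a c : in_rows A c -> in_rows A (a *: c).
Proof. by move=> [u ->]; exists (a *: u); rewrite scalemxAl. Qed.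

Lemma in_rows_seq n (s : seq 'rV[S]_n) :
  exists m (A : 'M_(m, n)), (forall c, c \in s -> in_rows A c) /\
    (forall Q : 'rV_n -> Prop, Q 0 -> (forall c d, Q c -> Q d -> Q (c + d)) ->
       (forall a c, Q c -> Q (a *: c)) -> (forall c, c \in s -> Q c) ->
       forall c, in_rows A c -> Q c).
Proof.
exists (size s), (\matrix_(i < size s) s`_i); split=> [c cs|Q Q0 QD QZ Qs c [d ->]].
  have ics : (index c s < size s)%N by rewrite index_mem.
  by exists (delta_mx 0 (Ordinal ics)); rewrite -rowE rowK /= nth_index.
rewrite mulmx_sum_row; elim/big_ind: _ => // i _.
by rewrite rowK; apply/QZ/Qs/mem_nth.
Qed.

End RowSpans.

(** * Finite families of orbits *)

Section OrbitFamilies.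
Variables (H : groupType) (X : gset H).
Local Notation ZH := (group_ring int H).

Definition app_fam n1 n2 (b1 : 'I_n1 -> X) (b2 : 'I_n2 -> X) (i : 'I_(n1 + n2)) :=
  match split i with inl j => b1 j | inr j => b2 j end.

Lemma orbv_app n1 n2 (b1 : 'I_n1 -> X) (b2 : 'I_n2 -> X) c :
  orbv (app_fam b1 b2) c = orbv b1 (lsubmx c) + orbv b2 (rsubmx c).
Proof.
rewrite /orbv big_split_ord /=.
apply: (f_equal2 +%R); apply: eq_bigr => i _.
  by rewrite mxE /app_fam (unsplitK (inl i)).
by rewrite mxE /app_fam (unsplitK (inr i)).
Qed.

Lemma coef_orbv_notin n (b : 'I_n -> X) c y :
  (forall i h, gs_act h (b i) <> y) -> (orbv b c)@_y = 0.
Proof.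
move=> by_; rewrite /orbv raddf_sum big1 // => i _.
by apply: coef_orb_notin => h; apply: by_.
Qed.

Definition disjoint_orbits n1 n2 (b1 : 'I_n1 -> X) (b2 : 'I_n2 -> X) :=
  forall i j h, gs_act h (b1 i) <> b2 j.

(** The supports of the two summands lie in disjoint unions of orbits. *)
Lemma orbv_app_eq0 n1 n2 (b1 : 'I_n1 -> X) (b2 : 'I_n2 -> X) c :
  disjoint_orbits b1 b2 ->
  orbv (app_fam b1 b2) c = 0 <-> orbv b1 (lsubmx c) = 0 /\ orbv b2 (rsubmx c) = 0.
Proof.
move=> dis; rewrite orbv_app; split=> [|[-> ->]]; last by rewrite addr0.
move=> c0; suff b1c : orbv b1 (lsubmx c) = 0 by rewrite -[X in _ /\ X = 0]add0r -{2}b1c.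
apply/malgP => y; rewrite mcoeff0.
have [[i [h iy]]|ny] := pselect (exists i h, gs_act h (b1 i) = y); last first.
  by apply: coef_orbv_notin => i h iy; apply: ny; exists i, h.
rewrite -(mcoeff0 y) -c0 mcoeffD [X in _ = _ + X]coef_orbv_notin ?addr0 // => j g jy.
by apply: (dis i j (g^-1 * h)%g); rewrite gs_actM iy -jy gs_actK.
Qed.

Lemma app_span_FP2 n1 n2 (b1 : 'I_n1 -> X) (b2 : 'I_n2 -> X) :
  disjoint_orbits b1 b2 -> span_FP2 b1 -> span_FP2 b2 -> span_FP2 (app_fam b1 b2).
Proof.
move=> dis [q1 [r1 [A1 [B1 [exA1 exB1]]]]] [q2 [r2 [A2 [B2 [exA2 exB2]]]]].
have diag n m n' m' (A : 'M[ZH]_(n, m)) (A' : 'M_(n', m')) d :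
    d *m block_mx A 0 0 A' = row_mx (lsubmx d *m A) (rsubmx d *m A').
  by rewrite -{1}[d]hsubmxK mul_row_block !mulmx0 addr0 add0r.
exists (q1 + q2)%N, (r1 + r2)%N, (block_mx A1 0 0 A2), (block_mx B1 0 0 B2).
split=> [c|d].
  rewrite orbv_app_eq0 // exA1 exA2; split=> [[[d1 c1] [d2 c2]]|[d ->]].
    by exists (row_mx d1 d2); rewrite diag row_mxKl row_mxKr -c1 -c2 hsubmxK.
  by rewrite diag row_mxKl row_mxKr; split; eexists.
rewrite diag; have -> : row_mx (lsubmx d *m A1) (rsubmx d *m A2) = 0 <->
    lsubmx d *m A1 = 0 /\ rsubmx d *m A2 = 0.
  split=> [|[-> ->]]; last by rewrite row_mx0.
  by rewrite -row_mx0 => /eq_row_mx.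
rewrite exB1 exB2; split=> [[[d1 c1] [d2 c2]]|[f ->]].
  by exists (row_mx d1 d2); rewrite diag row_mxKl row_mxKr -c1 -c2 hsubmxK.
by rewrite diag row_mxKl row_mxKr; split; eexists.
Qed.

Definition stab_by (K : groupType) (phi : {multiplicative K -> H}) (x : X) :=
  injective phi /\ forall h, gs_act h x = x <-> exists k, h = phi k.

Definition stab_FP2 (x : X) : Prop :=
  exists (K : groupType) (phi : {multiplicative K -> H}),
    stab_by phi x /\ free_FP2 K.

Fixpoint distinct_orbits (s : seq X) : Prop :=
  if s is x :: s' then
    (forall y h, y \in s' -> gs_act h x <> y) /\ distinct_orbits s'
  else True.

Lemma orbits_FP2 (s : seq X) :
  distinct_orbits s -> (forall x, x \in s -> stab_FP2 x) ->
  exists n (b : 'I_n -> X),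
    [/\ forall i, b i \in s, forall x, x \in s -> exists i, b i = x & span_FP2 b].
Proof.
elim: s => [|x s IHs] /=.
  exists 0%N, (fun i : 'I_0 => match notF (ltn_ord i) with end); split=> [[]//|//|].
  exists 0%N, 0%N, 0, 0; split=> c; rewrite (thinmx0 c) ?raddf0 ?mul0mx.
    by split=> // _; exists 0; rewrite mul0mx.
  by split=> // _; exists 0; rewrite mul0mx.
move=> [xs sd] st.
have {IHs} [|n2 [b2 [b2s sb2 fp2]]] := IHs sd.
  by move=> y ys; apply: st; rewrite inE ys orbT.
have [K [phi [[phi_inj stabP] /(orbit_FP2 phi_inj stabP)]]] := st x (mem_head _ _).
move=> [n1 [b1 [n1_gt0 b1x fp1]]].
exists (n1 + n2)%N, (app_fam b1 b2); split.
- by move=> i; rewrite /app_fam inE; case: (split i) => j; rewrite ?b1x ?eqxx ?b2s ?orbT.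
- move=> y; rewrite inE => /predU1P[->|/sb2[j <-]].
    by exists (lshift n2 (Ordinal n1_gt0)); rewrite /app_fam (unsplitK (inl _)).
  by exists (rshift n1 j); rewrite /app_fam (unsplitK (inr _)).
apply: app_span_FP2 => // i j h; rewrite b1x; exact: xs.
Qed.

Lemma orbit_transversal (s : seq X) : exists t : seq X,
  [/\ {subset t <= s}, distinct_orbits t
    & forall x, x \in s -> exists2 y, y \in t & exists h, x = gs_act h y].
Proof.
elim: s => [|x s [t [ts td st]]]; first by exists [::].
have [[y yt xy]|nx] := pselect (exists2 y, y \in t & exists h, x = gs_act h y).
  exists t; split=> // [z /ts zs|z]; first by rewrite inE zs orbT.
  by rewrite inE => /predU1P[->|/st//]; exists y.
exists (x :: t); split=> [z|/=|z].
- by rewrite !inE => /predU1P[->|/ts ->]; rewrite ?eqxx ?orbT.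
- split=> // y h yt xy; apply: nx; exists y => //; exists h^-1%g.
  by rewrite -xy gs_actK.
rewrite inE => /predU1P[->|/st[y yt yz]].
  by exists x; [exact: mem_head | exists 1%g; rewrite gs_act1].
by exists y => //; rewrite inE yt orbT.
Qed.

End OrbitFamilies.

(** * Generators of groups and of augmentation ideals *)

Section SubgroupsAsPredicates.
Variable G : groupType.

Definition subgroup_prop (Q : G -> Prop) :=
  [/\ Q 1%g, forall x y, Q x -> Q y -> Q (x * y)%g & forall x, Q x -> Q x^-1%g].

Definition generated_by (S : seq G) :=
  forall Q, subgroup_prop Q -> (forall s, s \in S -> Q s) -> forall x, Q x.

Section FromProp.
Variables (Q : G -> Prop) (QP : subgroup_prop Q).

Fact prop_mulg_closed : mulg_closed (fun x => `[< Q x >]).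
Proof. by case: QP => _ QM _ x y /asboolP Qx /asboolP Qy; apply/asboolP/QM. Qed.
Fact prop_group1 : 1%g \in (fun x => `[< Q x >]).
Proof. by case: QP => Q1 _ _; apply/asboolP. Qed.
Fact prop_invg_closed : invg_closed (fun x => `[< Q x >]).
Proof. by case: QP => _ _ QV x /asboolP Qx; apply/asboolP/QV. Qed.

Definition prop_subgroup : groupClosed G :=
  HB.pack (fun x => `[< Q x >])
    (isMulClosed.Build G _ prop_mulg_closed)
    (isMul1Closed.Build G _ prop_group1)
    (isInvClosed.Build G _ prop_invg_closed).

Lemma in_prop_subgroup x : x \in prop_subgroup <-> Q x.
Proof. by split=> [/asboolP|Qx]; last exact/asboolP. Qed.

End FromProp.

Lemma groupClosed_prop (K : groupClosed G) : subgroup_prop (fun x => x \in K).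
Proof. by split=> [|x y|x]; [exact: gpred1 | exact: gpredM | rewrite gpredV]. Qed.

(** The induction principle may be used with an arbitrary predicate, without
    packing it as a subgroup. *)
Lemma fgP : finitely_generated G <-> exists S, generated_by S.
Proof.
split=> -[S SP]; exists S; last by move=> K; apply: SP (groupClosed_prop K).
move=> Q QP SQ x; apply/(in_prop_subgroup QP)/SP => s /SQ.
exact: (in_prop_subgroup QP s).2.
Qed.

(** As [x y - 1 = x (y - 1) + (x - 1)], the elements [s - 1] for [s] in a
    generating set generate the augmentation ideal as a left ideal. *)
Lemma augmentation_ideal_ind (S : seq G) (J : group_ring int G -> Prop) :
  generated_by S ->
  J 0 -> (forall a b, J a -> J b -> J (a + b)) -> (forall a b, J b -> J (a * b)) ->
  (forall s, s \in S -> J (gel s - 1)) ->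
  forall a, augmentation a = 0 -> J a.
Proof.
move=> SP J0 JD JM JS.
have JN a : J a -> J (- a) by rewrite -mulN1r; apply: JM.
have Jx x : J (gel x - 1).
  apply: (SP (fun x => J (gel x - 1))) => //; split=> [|y z Jy Jz|y Jy].
  - by rewrite gel1 subrr.
  - have -> : gel (y * z)%g - 1 = gel y * (gel z - 1) + (gel y - 1).
      by rewrite mulrBr -gelM mulr1 addrA subrK.
    by apply: JD => //; apply: JM.
  have -> : gel y^-1%g - 1 = - (gel y^-1%g * (gel y - 1)).
    by rewrite mulrBr -gelM mulVg gel1 mulr1 opprB.
  exact/JN/JM.
have Ja a : J (a - 1 *~ augmentation a).
  elim/gr_int_ind: a => [|a b IHa IHb|g].
  - by rewrite augmentation0 mulr0z subr0.
  - rewrite augmentationB mulrzBr subrACA.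
    exact/JD/JN.
  by rewrite augmentation_gel mulr1z.
by move=> a a0; have := Ja a; rewrite a0 mulr0z subr0.
Qed.

(** The kernel of [Z[H]^n -> Z] is spanned by the augmentation ideal in one
    coordinate and by the differences of basis vectors. *)
Lemma fg_augmentation_kernel n : finitely_generated G -> (0 < n)%N ->
  exists m (W : 'M[group_ring int G]_(m, n)),
    forall c, augv c = 0 <-> in_rows W c.
Proof.
move=> /fgP[S SP] n0; pose i0 := Ordinal n0.
pose dl (i : 'I_n) : 'rV[group_ring int G]_n := delta_mx 0 i.
pose s := [seq (gel g - 1) *: dl i0 | g <- S] ++ [seq dl i - dl i0 | i <- enum 'I_n].
have [m [W [sW WP]]] := in_rows_seq s; exists m, W.
have augvD (c d : 'rV[group_ring int G]_n) : augv (c + d) = augv c + augv d.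
  by have := augv_is_linear 1 c d; rewrite scale1r augmentationU mul1r.
have augvZ a (c : 'rV[group_ring int G]_n) : augv (a *: c) = augmentation a * augv c.
  have := augv_is_linear a c 0; rewrite addr0 => ->.
  by rewrite [X in _ + X]/augv big1 ?addr0 // => i _; rewrite mxE raddf0.
have inD c d : in_rows W c -> in_rows W d -> in_rows W (c + d).
  by move=> cW [d' ->]; rewrite -[_ *m _]opprK -mulNmx; apply: in_rowsB => //; exists (- d').
have in0 : in_rows W 0 by exists 0; rewrite mul0mx.
move=> c; split=> [c0|]; last first.
  move: c; apply: WP => [|c d c0 d0|a c c0|c].
  - by rewrite /augv big1 // => i _; rewrite mxE raddf0.
  - by rewrite augvD c0 d0.
  - by rewrite augvZ c0 mulr0.
  rewrite mem_cat => /orP[] /mapP[x _ ->].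
    by rewrite augvZ raddfB /= augmentation_gel augmentationU subrr mul0r.
  by rewrite augvD -scaleN1r augvZ !augv_delta raddfN /= augmentationU addrN.
have -> : c = \sum_i c 0 i *: (dl i - dl i0) + (\sum_i c 0 i) *: dl i0.
  rewrite scaler_suml -big_split /= {1}(row_sum_delta c).
  by apply: eq_bigr => i _; rewrite -scalerDr subrK.
apply: (inD).
  apply: (big_ind (in_rows W)) => // i _.
  apply/in_rowsZ/sW.
  by rewrite mem_cat; apply/orP; right; apply: map_f; rewrite mem_enum.
apply: (augmentation_ideal_ind (J := fun a => in_rows W (a *: dl i0)) SP).
- by rewrite scale0r.
- by move=> a b Ja Jb; rewrite scalerDl; apply: (inD).
- by move=> a b Jb; rewrite -scalerA; apply: in_rowsZ.
- by move=> g gS; apply: sW; rewrite mem_cat (map_f (fun g => (gel g - 1) *: dl i0)).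
by rewrite raddf_sum.
Qed.

End SubgroupsAsPredicates.

(** * Finite generation of stabilizers *)

Section Stabilizers.
Variables (H : groupType) (X : gset H).
Local Notation ZH := (group_ring int H).

Lemma stab_prop (x : X) : subgroup_prop (fun h => gs_act h x = x).
Proof.
split=> [|g h gx hx|h hx]; rewrite ?gs_act1 ?gs_actM ?hx //.
by rewrite -{1}hx gs_actK.
Qed.

Definition stabg (x : X) : groupType := subgrp (prop_subgroup (stab_prop x)).

Definition stab_val (x : X) : {multiplicative stabg x -> H} := val.

Lemma stab_valP x (k : stabg x) : gs_act (stab_val x k) x = x.
Proof. by have /in_prop_subgroup := valP k. Qed.

Lemma stab_by_stabg (x : X) : stab_by (stab_val x) x.
Proof.
split=> [|h]; first exact: val_inj.
split=> [hx|[k ->]]; last exact: stab_valP.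
by exists (exist _ h ((in_prop_subgroup (stab_prop x) h).2 hx)).
Qed.

(** As [t] varies, these are the coordinates of the image of [a] in the
    permutation module on the cosets of [Q], so they vanish together on a left
    ideal ([coset_sum_mul0]). *)
Definition coset_sum (Q : H -> Prop) (t : H) (a : ZH) : int :=
  \sum_(h <- msupp a) a@_h *+ `[< Q (t^-1 * h)%g >].

Lemma coset_sumE Q t a :
  coset_sum Q t a = lext (fun h => (`[< Q (t^-1 * h)%g >]%:R : int^o)) a.
Proof.
rewrite /coset_sum /lext; apply: eq_bigr => h _.
exact: (esym (mulr_natr _ _)).
Qed.

Lemma coset_sumB Q t : zmod_morphism (coset_sum Q t).
Proof. by move=> a b; rewrite !coset_sumE [LHS]raddfB. Qed.

Lemma coset_sum_gel Q t h : coset_sum Q t (gel h) = `[< Q (t^-1 * h)%g >]%:R.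
Proof. by rewrite coset_sumE [LHS]lextU. Qed.

Lemma coset_sum0 Q t : coset_sum Q t 0 = 0.
Proof. by rewrite coset_sumE raddf0. Qed.

Lemma coset_sum_mul0 Q a b :
  (forall t, coset_sum Q t b = 0) -> forall t, coset_sum Q t (a * b) = 0.
Proof.
move=> b0 t; elim/gr_int_ind: a => [|a a' IH IH'|h].
- by rewrite mul0r coset_sum0.
- by rewrite mulrBl coset_sumB IH IH'.
rewrite -(b0 (h^-1 * t)%g).
elim/gr_int_ind: b {b0} => [|b b' IH IH'|g]; first by rewrite mulr0 !coset_sum0.
  by rewrite mulrBr !coset_sumB IH IH'.
by rewrite -gelM !coset_sum_gel invgM invgK mulgA.
Qed.

(** The relation [a x = 0] says that the coefficients of [a] sum to zero over
    each coset of the stabilizer.  Only the finitely many quotients of elements of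
    the support matter: a subgroup [Q] that contains those lying in the stabilizer
    splits the support in the same way. *)
Lemma relation_support (x : X) (a : ZH) : orb x a = 0 ->
  exists l : seq H, (forall k, k \in l -> gs_act k x = x) /\
    forall Q, subgroup_prop Q -> (forall k, Q k -> gs_act k x = x) ->
      (forall k, k \in l -> Q k) -> forall t, coset_sum Q t a = 0.
Proof.
move=> xa; exists [seq k <- [seq (g^-1 * h)%g | g <- msupp a, h <- msupp a] |
                    gs_act k x == x].
split=> [k|Q [Q1 QM QV] Qx lQ t]; first by rewrite mem_filter => /andP[/eqP].
have [[g ga tg]|ng] := pselect (exists2 g, g \in msupp a & Q (t^-1 * g)%g); last first.
  rewrite /coset_sum big_seq big1 // => h ha; case: asboolP => // th.
  by case: ng; exists h.
transitivity ((orb x a)@_(gs_act g x)); last by rewrite xa mcoeff0.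
rewrite [orb x a]/lext raddf_sum /coset_sum; apply: eq_big_seq => h ha /=.
rewrite mcoeffZ mcoeffU mulr_natr; congr (_ *+ nat_of_bool _).
apply/asboolP/eqP => [th|hx].
  have /Qx : Q (g^-1 * h)%g.
    have -> : (g^-1 * h = (t^-1 * g)^-1 * (t^-1 * h))%g.
      by rewrite invgM invgK mulgA mulgK.
    exact/QM/th/QV.
  by move=> /(congr1 (gs_act g)); rewrite -gs_actM mulVKg.
have -> : (t^-1 * h = (t^-1 * g) * (g^-1 * h))%g by rewrite mulgA mulgK.
apply: QM => //; apply: lQ; rewrite mem_filter gs_actM hx gs_actK eqxx /=.
by apply/allpairsP; exists (g, h).
Qed.

Lemma orbv_separate n (b : 'I_n -> X) c :
  (forall i j h, gs_act h (b i) = b j -> i = j) ->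
  orbv b c = 0 -> forall i, orb (b i) (c 0 i) = 0.
Proof.
move=> b_inj c0 i; apply/malgP => y; rewrite mcoeff0.
have [[h <-]|ny] := pselect (exists h, gs_act h (b i) = y); last first.
  by apply: coef_orb_notin => h hy; apply: ny; exists h.
have : (orbv b c)@_(gs_act h (b i)) = 0 by rewrite c0 mcoeff0.
rewrite /orbv (raddf_sum (mcoeff _)) (bigD1 i) //= big1 ?addr0 // => j ji.
apply: coef_orb_notin => g gj; case/eqP: ji; apply: (b_inj j i (h^-1 * g)%g).
by rewrite gs_actM gj gs_actK.
Qed.

(** The stabilizer elements used by finitely many generating relations generate a
    subgroup [Q] for which all relations at [b i] hold already in the permutation
    module on the cosets of [Q]; the relation [h - 1] then puts each [h] of the
    stabilizer in [Q]. *)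
Lemma fg_stabilizer n (b : 'I_n -> X) k (R : 'M[ZH]_(k, n)) :
  (forall i j h, gs_act h (b i) = b j -> i = j) ->
  (forall c, orbv b c = 0 <-> in_rows R c) ->
  forall i, finitely_generated (stabg (b i)).
Proof.
move=> b_inj RP i.
have /choice[l lP] : forall j : 'I_k, exists l : seq H,
    (forall h, h \in l -> gs_act h (b i) = b i) /\
    forall Q, subgroup_prop Q -> (forall h, Q h -> gs_act h (b i) = b i) ->
      (forall h, h \in l -> Q h) -> forall t, coset_sum Q t (R j i) = 0.
  move=> j; apply: relation_support.
  have : orbv b (row j R) = 0 by apply/RP; exists (delta_mx 0 j); rewrite -rowE.
  by move=> /(orbv_separate b_inj)/(_ i); rewrite mxE.
pose L := flatten [seq l j | j <- enum 'I_k].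
have Lstab h : h \in L -> gs_act h (b i) = b i.
  by move=> /flatten_mapP[j _]; apply: (lP j).1.
pose Q h := forall Q', subgroup_prop Q' -> (forall h', h' \in L -> Q' h') -> Q' h.
have QP : subgroup_prop Q.
  split=> [Q' []//|x y Qx Qy Q' Q'P LQ'|x Qx Q' Q'P LQ']; case: (Q'P) => _ QM QV.
    by apply: QM; [apply: Qx | apply: Qy].
  by apply: QV; apply: Qx.
have Qstab h : Q h -> gs_act h (b i) = b i.
  by move=> Qh; apply: (Qh (fun h => gs_act h (b i) = b i)) => //; apply: stab_prop.
have stabQ h : gs_act h (b i) = b i -> Q h.
  move=> hi; pose c : 'rV[ZH]_n := (gel h - 1) *: delta_mx 0 i.
  have [d dP] : in_rows R c.
    by apply/RP; rewrite orbv_delta orbB -gel1 !orb_gel hi gs_act1 subrr.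
  have : coset_sum Q 1%g (c 0 i) = 0.
    rewrite dP mxE; elim/big_ind: _ => [|x y x0 y0|j _]; first exact: coset_sum0.
      by rewrite -[y]opprK -[- y]sub0r !coset_sumB coset_sum0 x0 y0.
    apply: coset_sum_mul0; apply: (lP j).2 => // g gl g' Q'P; apply.
    by apply/flatten_mapP; exists j; rewrite ?mem_enum.
  rewrite /c !mxE !eqxx mulr1 coset_sumB -gel1 !coset_sum_gel invg1 !mul1g.
  case: (QP) => Q1 _ _; rewrite (asboolT Q1).
  by case: asboolP.
exists (pmap insub L) => K SK x.
suff [y [yx Ky]] : exists y : stabg (b i), val y = val x /\ y \in K.
  by rewrite -(val_inj yx).
apply: (stabQ _ (stab_valP x) (fun h => exists y : stabg (b i), val y = h /\ y \in K)).
  split=> [|_ _ [y [<- Ky]] [z [<- Kz]]|_ [y [<- Ky]]].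
  - by exists 1%g; split=> //; apply: gpred1.
  - by exists (y * z)%g; split=> //; apply: gpredM.
  by exists y^-1%g; split=> //; rewrite gpredV.
move=> h hL; have hi := (in_prop_subgroup (stab_prop (b i)) h).2 (Lstab h hL).
exists (Sub h hi); split; first exact: SubK.
apply: SK; rewrite mem_pmap; apply/mapP; exists h => //.
by rewrite insubT.
Qed.

Lemma distinct_orbits_nth (s : seq X) x0 i j h :
  distinct_orbits s -> (i < size s)%N -> (j < size s)%N ->
  gs_act h (nth x0 s i) = nth x0 s j -> i = j.
Proof.
elim: s i j => [//|x s IHs] [|i] [|j] //= [xs sd] si sj.
- by move=> /xs; case; apply: mem_nth.
- move=> hx; case: (xs (nth x0 s i) h^-1%g); first exact: mem_nth.
  by rewrite -hx gs_actK.
by move=> hx; congr _.+1; apply: IHs hx.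
Qed.

End Stabilizers.

(** * Groups acting on forests *)

Inductive reach (V E : Type) (st tt : E -> V) (F : E -> Prop) (v0 : V) : V -> Prop :=
| ReachBase : reach st tt F v0 v0
| ReachFwd e : F e -> reach st tt F v0 (st e) -> reach st tt F v0 (tt e)
| ReachBwd e : F e -> reach st tt F v0 (tt e) -> reach st tt F v0 (st e).

Lemma reach_mono (V E : Type) (st tt : E -> V) (F F' : E -> Prop) v0 v :
  (forall e, F e -> F' e) -> reach st tt F v0 v -> reach st tt F' v0 v.
Proof.
move=> FF'; elim=> [|e /FF' Fe _|e /FF' Fe _]; first exact: ReachBase.
  exact: ReachFwd.
exact: ReachBwd.
Qed.

(** The edges of a path all lie in the component of its origin, so they may be
    added to a connected finite graph. *)
Lemma reach_finite (V : Type) (E : eqType) (st tt : E -> V) F v0 v :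
  reach st tt F v0 v -> exists s : seq E,
    (forall e, e \in s -> reach st tt (fun e => e \in s) v0 (st e)) /\
    reach st tt (fun e => e \in s) v0 v.
Proof.
have mono e s w : reach st tt (fun e => e \in s) v0 w ->
    reach st tt (fun e' => e' \in e :: s) v0 w.
  by apply: reach_mono => e' e's; rewrite inE e's orbT.
elim=> [|e Fe _ [s [ss se]]|e Fe _ [s [ss se]]].
- by exists [::]; split=> //; apply: ReachBase.
- exists (e :: s); split=> [e'|]; last first.
    by apply: ReachFwd; [exact: mem_head | exact: mono].
  by rewrite inE => /predU1P[->|/ss] ; apply: mono.
have est : reach st tt (fun e' => e' \in e :: s) v0 (st e).
  by apply: ReachBwd; [exact: mem_head | exact: mono].
exists (e :: s); split=> // e'; rewrite inE => /predU1P[->//|/ss].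
exact: mono.
Qed.

Section Forest.
Variables (H : groupType) (V E : gset H) (st tt : E -> V).
Hypothesis stM : forall h e, st (gs_act h e) = gs_act h (st e).
Hypothesis ttM : forall h e, tt (gs_act h e) = gs_act h (tt e).
(* This [sec] makes the boundary map injective: it replaces the absence of
   cycles, and is what crossed homomorphisms provide. *)
Variable sec : V -> {malg int[E]}.
Hypothesis secP : forall e, sec (tt e) - sec (st e) = << e >>.
Variable v0 : V.
Hypothesis v0_reach : forall h, reach st tt (fun=> True) v0 (gs_act h v0).
Hypothesis H_fg : finitely_generated H.
Hypothesis edge_stab : forall e : E, free_FP2 (stabg e).
Hypothesis vertex_stab : forall v : V, finitely_generated (stabg v) -> free_FP2 (stabg v).
Local Notation ZH := (group_ring int H).

Definition bd (m : {malg int[E]}) : {malg int[V]} :=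
  lext (fun e => << tt e >> - << st e >>) m.

Fact bdB : zmod_morphism bd. Proof. exact: raddfB. Qed.

HB.instance Definition _ := GRing.isZmodMorphism.Build _ _ bd bdB.

Lemma bdU e : bd << e >> = << tt e >> - << st e >>.
Proof. exact: lextU. Qed.

Lemma bd_translate h m : bd (translate h m) = translate h (bd m).
Proof.
elim/malg_int_ind: m => [|a b IHa IHb|e]; first by rewrite !raddf0.
  by rewrite translateB !bdB translateB IHa IHb.
by rewrite translateU !bdU translateB !translateU stM ttM.
Qed.

Lemma bd_inj m : bd m = 0 -> m = 0.
Proof.
have secK : lext sec (bd m) = m.
  elim/malg_int_ind: m => [|a b IHa IHb|e]; first by rewrite !raddf0.
    by rewrite bdB [LHS]raddfB /= IHa IHb.
  by rewrite bdU [LHS]raddfB /= !lextU secP.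
by rewrite -{2}secK => ->; rewrite raddf0.
Qed.

Definition total (m : {malg int[V]}) : int := lext (fun=> 1 : int^o) m.

Lemma totalB : zmod_morphism total.
Proof. by move=> a b; rewrite /total [LHS]raddfB. Qed.

Lemma totalU v : total << v >> = 1. Proof. by rewrite /total [LHS]lextU. Qed.

Lemma total0 : total 0 = 0. Proof. by rewrite /total [LHS]raddf0. Qed.

Lemma total_bd m : total (bd m) = 0.
Proof.
elim/malg_int_ind: m => [|a b IHa IHb|e]; first by rewrite raddf0 total0.
  by rewrite bdB totalB IHa IHb.
by rewrite bdU totalB !totalU.
Qed.

Lemma total_orb v a : total (orb v a) = augmentation a.
Proof.
elim/gr_int_ind: a => [|a b IHa IHb|h]; first by rewrite !raddf0 total0.
  by rewrite orbB totalB augmentationB IHa IHb.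
by rewrite orb_gel totalU augmentation_gel.
Qed.

Lemma total_orbv n (b : 'I_n -> V) c : total (orbv b c) = augv c.
Proof.
have totalD x y : total (x + y) = total x + total y by rewrite /total [LHS]raddfD.
rewrite /orbv (big_morph _ totalD total0) /augv.
by apply: eq_bigr => i _; rewrite total_orb.
Qed.

Section Compare.
Variables (nE : nat) (bE : 'I_nE -> E).

(** The invariant subgraph is represented only by the span of its edges; its
    vertices are those that differ from [v0] by such a boundary. *)
Definition bounds (m : {malg int[V]}) := exists mu, m = bd (orbv bE mu).

Lemma bounds0 : bounds 0.
Proof. by exists 0; rewrite !raddf0. Qed.

Lemma boundsB m m' : bounds m -> bounds m' -> bounds (m - m').
Proof. by move=> [mu ->] [mu' ->]; exists (mu - mu'); rewrite orbvB bdB. Qed.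

Lemma boundsD m m' : bounds m -> bounds m' -> bounds (m + m').
Proof.
move=> bm bm'; rewrite -[m']opprK; apply: boundsB => //.
by rewrite -sub0r; apply: boundsB => //; apply: bounds0.
Qed.

Lemma bounds_translate h m : bounds m -> bounds (translate h m).
Proof. by move=> [mu ->]; exists (gel h *: mu); rewrite orbv_gelZ bd_translate. Qed.

Lemma bounds_edge h j : bounds (bd << gs_act h (bE j) >>).
Proof. by exists (gel h *: delta_mx 0 j); rewrite orbv_delta orb_gel. Qed.

Lemma bounds_reach F v : (forall e, F e -> exists j h, e = gs_act h (bE j)) ->
  reach st tt F v0 v -> bounds (<< v >> - << v0 >>).
Proof.
move=> FbE; elim=> [|e /FbE[j [h ->]] _ IH|e /FbE[j [h ->]] _ IH].
- by rewrite subrr; apply: bounds0.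
- move: (boundsD (bounds_edge h j) IH); rewrite bdU addrA subrK.
  by move=> ?.
- move: (boundsB IH (bounds_edge h j)); rewrite bdU opprB addrC addrA subrK.
  by [].
Qed.

Variables (nV : nat) (bV : 'I_nV -> V).
Hypothesis start0 : forall h, bounds (<< gs_act h v0 >> - << v0 >>).
Hypothesis bV0 : forall i, bounds (<< bV i >> - << v0 >>).
Hypothesis st_bV : forall j, exists i h, st (bE j) = gs_act h (bV i).
Hypothesis tt_bV : forall j, exists i h, tt (bE j) = gs_act h (bV i).

(** The matrix of the boundary map in the generators [bE] and [bV]. *)
Lemma boundary_matrix : exists beta : 'M[ZH]_(nE, nV),
  forall mu, orbv bV (mu *m beta) = bd (orbv bE mu).
Proof.
have /choice[f fP] : forall j, exists c, orbv bV c = bd << bE j >>.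
  move=> j; have [i [h tj]] := tt_bV j; have [i' [h' sj]] := st_bV j.
  exists (gel h *: delta_mx 0 i - gel h' *: delta_mx 0 i').
  by rewrite orbvB !orbv_delta !orb_gel bdU tj sj.
exists (\matrix_j f j) => mu; rewrite mulmx_sum_row raddf_sum /orbv raddf_sum.
apply: eq_bigr => j _ /=; rewrite rowK; move: (mu 0 j) => a.
elim/gr_int_ind: a => [|a b IHa IHb|h].
- by rewrite scale0r !raddf0.
- by rewrite scalerBl orbvB orbB bdB IHa IHb.
by rewrite orbv_gelZ fP orb_gel -bd_translate translateU.
Qed.

Lemma augv_bounds c : augv c = 0 <-> bounds (orbv bV c).
Proof.
split=> [c0|[mu cmu]]; last by rewrite -(total_orbv bV) cmu total_bd.
suff : bounds (orbv bV c - << v0 >> *~ augv c) by rewrite c0 mulr0z subr0.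
have -> : orbv bV c - << v0 >> *~ augv c =
    \sum_i (orb (bV i) (c 0 i) - << v0 >> *~ augmentation (c 0 i)).
  by rewrite sumrB -mulrz_sumr.
elim/big_ind: _ => [|m m'|i _]; [exact: bounds0 | exact: boundsD |].
move: (c 0 i) => a; elim/gr_int_ind: a => [|a b IHa IHb|h].
- by rewrite raddf0 augmentation0 mulr0z subr0; apply: bounds0.
- by rewrite orbB augmentationB mulrzBr subrACA; apply: boundsB.
rewrite orb_gel augmentation_gel mulr1z.
move: (boundsD (bounds_translate h (bV0 i)) (start0 h)).
by rewrite translateB !translateU addrA subrK.
Qed.

(** Exactness of [Z[E] -> Z[V] -> Z] at [Z[V]], in terms of generators. *)
Lemma augv_relations (beta : 'M[ZH]_(nE, nV)) :
  (forall mu, orbv bV (mu *m beta) = bd (orbv bE mu)) ->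
  forall c, augv c = 0 <-> exists mu, orbv bV (c - mu *m beta) = 0.
Proof.
move=> betaP c; rewrite augv_bounds; split=> -[mu muP]; exists mu.
  by rewrite orbvB muP betaP subrr.
by apply/eqP; rewrite -subr_eq0 -betaP -orbvB muP.
Qed.

End Compare.

Lemma stab_FP2_free (X : gset H) (x : X) : free_FP2 (stabg x) -> stab_FP2 x.
Proof. by move=> fp; exists (stabg x), (stab_val x); split=> //; apply: stab_by_stabg. Qed.

(** The vertices of the relevant subgraph are treated twice: with one generator
    per orbit to bound the stabilizers, and then with the generators coming from
    resolutions over the stabilizers. *)
Theorem forest_FP2 : free_FP2 H.
Proof.
have /fgP[S SP] := H_fg.
(* [F] carries paths from [v0] to its images under the generators. *)
have [F [Fst FS]] : exists F : seq E,
    (forall e, e \in F -> reach st tt (fun e => e \in F) v0 (st e)) /\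
    (forall s, s \in S -> reach st tt (fun e => e \in F) v0 (gs_act s v0)).
  have {SP} [f fP] := choice (fun s => reach_finite (v0_reach s)).
  exists (flatten [seq f s | s <- S]).
  have sub s : s \in S -> forall e, e \in f s -> e \in flatten [seq f s | s <- S].
    by move=> sS e es; apply/flatten_mapP; exists s.
  split=> [e /flatten_mapP[s sS es]|s sS].
    by apply: (reach_mono (sub s sS)); apply: (fP s).1.
  by apply: (reach_mono (sub s sS)); apply: (fP s).2.
have [tE [tEF tEd tEP]] := orbit_transversal F.
have [nE [bE [bEt tEb fpE]]] := orbits_FP2 tEd (fun e _ => stab_FP2_free (edge_stab e)).
have FbE e : e \in F -> exists j h, e = gs_act h (bE j).
  by move=> /tEP[e' /tEb[j <-] [h ->]]; exists j, h.
have bEF j : bE j \in F by apply/tEF/bEt.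
have start0 h : bounds bE (<< gs_act h v0 >> - << v0 >>).
  apply: (SP (fun h => bounds bE (<< gs_act h v0 >> - << v0 >>))); last first.
    by move=> s /FS; apply: bounds_reach.
  split=> [|g k gP kP|g gP]; first by rewrite gs_act1 subrr; apply: bounds0.
    move: (boundsD (bounds_translate g kP) gP).
    by rewrite translateB !translateU addrA subrK gs_actM.
  move: (boundsB (bounds0 bE) (bounds_translate g^-1%g gP)).
  by rewrite translateB !translateU gs_actK sub0r opprB.
pose L := v0 :: [seq st (bE j) | j <- enum 'I_nE] ++ [seq tt (bE j) | j <- enum 'I_nE].
have L0 v : v \in L -> bounds bE (<< v >> - << v0 >>).
  rewrite inE mem_cat => /predU1P[->|/orP[] /mapP[j _ ->]].
  - by rewrite subrr; apply: bounds0.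
  - exact: bounds_reach (Fst _ (bEF j)).
  apply: (bounds_reach FbE); apply: ReachFwd; first exact: bEF.
  exact: Fst (bEF j).
have stL j : st (bE j) \in L.
  by rewrite inE mem_cat [X in _ || (X || _)]map_f ?orbT // mem_enum.
have ttL j : tt (bE j) \in L.
  by rewrite inE mem_cat [X in _ || (_ || X)]map_f ?orbT // mem_enum.
have [tV [tVL tVd tVP]] := orbit_transversal L.
have v0L : v0 \in L by exact: mem_head.
have [qE [rE [Y [Y' [YP _]]]]] := fpE.
(* Exactness with one generator per orbit makes the stabilizers finitely
   generated. *)
have vertex_FP2 v : v \in tV -> stab_FP2 v.
  move=> vtV; apply/stab_FP2_free/vertex_stab.
  pose b (i : 'I_(size tV)) := nth v0 tV i.
  have b_nth w : w \in tV -> exists i, b i = w.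
    by rewrite -index_mem => wi; exists (Ordinal wi); rewrite /b nth_index // -index_mem.
  have bL w : w \in L -> exists i h, w = gs_act h (b i).
    by move=> /tVP[w' /b_nth[i <-] [h ->]]; exists i, h.
  have [i0 _] := bL _ v0L.
  have [beta betaP] := boundary_matrix (fun j => bL _ (stL j)) (fun j => bL _ (ttL j)).
  have b0 i : bounds bE (<< b i >> - << v0 >>) by apply/L0/tVL/mem_nth.
  have [m [W WP]] := fg_augmentation_kernel H_fg (leq_ltn_trans (leq0n i0) (ltn_ord i0)).
  have [] := @fg_relations _ _ _ _ _ Y W beta (fun c => orbv b c = 0).
  - by rewrite raddf0.
  - by move=> c d c0 d0; rewrite orbvB c0 d0 subrr.
  - by move=> a c; apply: orbvZ_eq0.
  - by move=> c; rewrite -WP; apply: augv_relations start0 b0 _ betaP c.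
  - move=> mu; rewrite betaP -[in_rows _ _]/(exists d, mu = d *m Y) -YP.
    by split=> [/bd_inj|->]; rewrite ?raddf0.
  move=> k [R RP]; have [i <-] := b_nth v vtV.
  apply: (fg_stabilizer (R := R)) => // i' j' h hij.
  exact/val_inj/(distinct_orbits_nth tVd (ltn_ord i') (ltn_ord j') hij).
have [nV [bV [bVt tVb [qV [rV [R [Z [RP ZP]]]]]]]] := orbits_FP2 tVd vertex_FP2.
have bL w : w \in L -> exists i h, w = gs_act h (bV i).
  by move=> /tVP[w' /tVb[i <-] [h ->]]; exists i, h.
have [beta betaP] := boundary_matrix (fun j => bL _ (stL j)) (fun j => bL _ (ttL j)).
have b0 i : bounds bE (<< bV i >> - << v0 >>) by apply/L0/tVL/bVt.
have [i0 _] := bL _ v0L.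
have [||q [r [A [B [AP BP]]]]] :=
    resolve_cokernel (Y := Y) (beta := beta) (RC := fun c => augv c = 0) ZP.
- move=> c; rewrite (augv_relations start0 b0 betaP).
  by split=> -[mu muP]; exists mu; apply/RP.
- move=> mu; rewrite -[in_rows R _]/(exists d, mu *m beta = d *m R) -RP betaP.
  rewrite -[in_rows Y _]/(exists d, mu = d *m Y) -YP.
  by split=> [/bd_inj|->]; rewrite ?raddf0.
exists nV, q, r, A, B; split=> //.
exact: leq_ltn_trans (leq0n i0) (ltn_ord i0).
Qed.

End Forest.

(** * Cyclic groups and groups of rational numbers *)

Section CyclicGroups.
Variable G : groupType.

Lemma generated_cyclic (g : G) :
  (forall x, exists n, x = (g ^+ n)%g \/ x = (g ^- n)%g) -> generated_by [:: g].
Proof.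
move=> gP Q [Q1 QM QV] Qs x.
have Qg : Q g by apply: Qs; rewrite inE.
have Qn n : Q (g ^+ n)%g by elim: n => [|n IHn]; rewrite ?expg0 ?expgS //; apply: QM.
by have [n [->|->]] := gP x; last apply: QV.
Qed.

Lemma coef_norm (s : seq G) z h : uniq s -> h \in s ->
  (\sum_(x <- s) << z *g x >> : group_ring int G)@_h = z.
Proof.
move=> us hs; rewrite (raddf_sum (mcoeff h)) (bigD1_seq h) //=.
rewrite mcoeffUU big1 ?addr0 // => x /negPf xh.
by rewrite mcoeffU xh.
Qed.

(** Over the group ring of a cyclic group, the annihilator of [g - 1] is spanned
    by the norm element when the group is finite, and is [0] when it is infinite. *)
Lemma cyclic_FP2 : cyclic_group G -> free_FP2 G.
Proof.
move=> [g /generated_cyclic gP].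
pose D : group_ring int G := gel g - 1.
have rv1 (c d : 'rV[group_ring int G]_1) a :
    c = d *m const_mx a <-> c 0 0 = d 0 0 * a.
  split=> [->|cd]; first by rewrite mxE big_ord1 !mxE.
  by apply/rowP => i; rewrite ord1 mxE big_ord1 mxE.
suff [N NP] : exists N, forall d, d * D = 0 <-> exists f, d = f * N.
  exists 1%N, 1%N, 1%N, (const_mx D), (const_mx N); split=> // [c|d].
    rewrite /augv big_ord1; split=> [c0|[d /rv1 ->]]; last first.
      by rewrite augmentationM augmentationB augmentation_gel augmentationU subrr mulr0.
    suff [d dP] : exists d, c 0 0 = d * D.
      by exists (const_mx d); apply/rv1; rewrite mxE.
    apply: (augmentation_ideal_ind (J := fun a => exists d, a = d * D) gP) => //.
    - by exists 0; rewrite mul0r.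
    - by move=> _ _ [d ->] [e ->]; exists (d + e); rewrite mulrDl.
    - by move=> a _ [d ->]; exists (a * d); rewrite mulrA.
    by move=> s; rewrite inE => /eqP ->; exists 1; rewrite mul1r.
  have -> : d *m (const_mx D : 'M_1) = 0 <-> d 0 0 * D = 0.
    have := rv1 0 d D; rewrite mxE => -[r1 r2].
    by split=> e; apply/esym; [exact: r1 (esym e) | exact: r2 (esym e)].
  rewrite NP; split=> [[f fP]|[f /rv1 ->]]; last by exists (f 0 0).
  by exists (const_mx f); apply/rv1; rewrite mxE.
have const d : d * D = 0 -> forall x, d@_x = d@_1%g.
  rewrite mulrBr mulr1 => /eqP; rewrite subr_eq0 => /eqP dg x.
  suff dx : forall h, d@_(h * x^-1)%g = d@_h by rewrite -(dx x) mulgV.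
  apply: (gP (fun x => forall h, d@_(h * x^-1)%g = d@_h)) => [|s]; last first.
    by rewrite inE => /eqP -> h; rewrite -{2}dg coef_mul_gel.
  split=> [h|y z yP zP h|y yP h]; first by rewrite invg1 mulg1.
    by rewrite invgM mulgA yP zP.
  by rewrite invgK -(yP (h * y)%g) mulgK.
have [[s sG]|inf] := pselect (exists s : seq G, forall x, x \in s); last first.
  exists 0 => d; split=> [/const dx|[f ->]]; last by rewrite mulr0 mul0r.
  exists 0; rewrite mulr0; have [x xd] : exists x, x \notin msupp d.
    apply/not_existsP => all_d; apply: inf; exists (msupp d) => x.
    by have /negP := all_d x; rewrite negbK.
  by apply/malgP => h; rewrite mcoeff0 dx -(dx x) mcoeff_outdom.
pose N : group_ring int G := \sum_(x <- undup s) << 1 *g x >>.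
have sG' x : x \in undup s by rewrite mem_undup.
exists N => d; split=> [/const dx|[f ->]].
  exists << d@_1%g *g 1%g >>; apply/malgP => h.
  have -> : (<< d@_1%g *g 1%g >> : group_ring int G) * N =
      \sum_(x <- undup s) << d@_1%g *g x >>.
    rewrite mulr_sumr; apply: eq_bigr => x _.
    by rewrite [LHS]gr_mulUU mulr1 mul1g.
  by rewrite coef_norm ?undup_uniq // dx.
suff NgN : N * D = 0 by rewrite -mulrA NgN mulr0.
rewrite mulrBr mulr1; apply/eqP; rewrite subr_eq0; apply/eqP/malgP => h.
by rewrite coef_mul_gel !coef_norm ?undup_uniq.
Qed.

(** [P] is the graph of a homomorphism from a subgroup of [Z] onto [G].  Both
    subgroups of cyclic groups and finitely generated groups of rationals are
    naturally presented in this form, with no map from [Z] itself. *)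
Lemma int_subquotient_cyclic (P : int -> G -> Prop) :
  (forall m n x y, P m x -> P n y -> P (m - n) (x * y^-1)%g) ->
  (forall x, exists m, P m x) ->
  (forall m x y, P m x -> P m y -> x = y) -> cyclic_group G.
Proof.
move=> PB Pex Pinj.
have P0 : P 0 1%g by have [m Pm] := Pex 1%g; have := PB _ _ _ _ Pm Pm; rewrite subrr mulgV.
have PN m x : P m x -> P (- m) x^-1%g by move=> /(PB _ _ _ _ P0); rewrite sub0r mul1g.
have PD m n x y : P m x -> P n y -> P (m + n) (x * y)%g.
  by move=> Pm /PN/(PB _ _ _ _ Pm); rewrite opprK invgK.
have [exd|nod] := pselect (exists n : nat, (0 < n)%N && `[< exists x, P n x >]); last first.
  exists 1%g => x; exists 0%N; left; apply: (Pinj 0) => //.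
  have [m Pm] := Pex x; suff m0 : m = 0 by rewrite -m0.
  apply/eqP/negPn/negP => m0; apply: nod; exists `|m|%N.
  rewrite absz_gt0 m0; apply/asboolP.
  by case: m {m0} Pm => n Pn; [exists x | exists x^-1%g; apply: (PN (Negz n))].
have [/= d /andP[d0 /asboolP[g Pg]] d_min] := ex_minnP exd.
have Pgn n : P (n%:Z * d%:Z) (g ^+ n)%g.
  elim: n => [|n IHn]; first by rewrite mul0r expg0.
  by rewrite -[n.+1]add1n PoszD mulrDl mul1r expgS; apply: PD.
exists g => x; have [m Pm] := Pex x.
have d0' : d%:Z != 0 by rewrite -lt0n in d0 *; case: (d) d0.
have [y Py] : exists y, P ((m %/ d)%Z * d) y /\ exists n, y = (g ^+ n)%g \/ y = (g ^- n)%g.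
  case: (m %/ d)%Z => n; first by exists (g ^+ n)%g; split; [|exists n; left].
  exists (g ^- n.+1)%g; split; last by exists n.+1; right.
  by rewrite NegzE mulNr; apply: PN.
case: Py => Py [n yn]; exists n.
suff -> : x = y by [].
have := PB _ _ _ _ Pm Py; rewrite {1}(divz_eq m d) [_ + _ - _]addrC addKr => Pr.
have r0 : (m %% d)%Z = 0.
  apply/eqP/negPn/negP => r0.
  have := modz_ge0 m d0'; case: (m %% d)%Z (ltz_mod m d0') r0 Pr => // r ltr r0 Pr _.
  have := d_min r; rewrite lt0n; have -> /= : r != 0%N by [].
  have -> : `[< exists x, P r x >] by apply/asboolP; exists (x * y^-1)%g.
  by move=> /(_ isT); rewrite leqNgt; move: ltr; rewrite /= ltz_nat => ->.
move: Pr; rewrite r0 => /Pinj /(_ P0) /(congr1 (fun z => z * y)%g).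
by rewrite mulgVK mul1g.
Qed.

Lemma expgVn_commute (g : G) (m n : nat) : (g ^- n * g ^+ m = g ^+ m * g ^- n)%g.
Proof. exact/esym/commuteV/commuteX2/commute_refl. Qed.

Lemma expg_quotient_eq (g : G) (a b c d : nat) :
  (a + d = c + b)%N -> (g ^+ a * g ^- b = g ^+ c * g ^- d)%g.
Proof.
move=> e; apply: (mulIg (g ^+ d)%g).
by rewrite -mulgA expgVn_commute mulgA -expgnDr e expgnDr mulgK mulgVK.
Qed.

End CyclicGroups.

Definition powers (G : groupType) (g x : G) : Prop :=
  exists a b : nat, x = (g ^+ a * g ^- b)%g.

Lemma powersVM (G : groupType) (g : G) (a b c d : nat) :
  (g ^+ a * g ^- b * (g ^+ c * g ^- d)^-1 = g ^+ (a + d) * g ^- (c + b))%g.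
Proof.
rewrite invgM invgK !expgnDr invgM.
by rewrite -mulgA (mulgA _ (g ^+ d)%g) expgVn_commute !mulgA.
Qed.

Lemma powers_subgroup (G : groupType) (g : G) : subgroup_prop (powers g).
Proof.
have P1 : powers g 1%g by exists 0%N, 0%N; rewrite mulgV.
have PF x y : powers g x -> powers g y -> powers g (x * y^-1)%g.
  move=> [a [b ->]] [c [d ->]]; exists (a + d)%N, (c + b)%N; exact: powersVM.
have PV x : powers g x -> powers g x^-1%g by move=> /(PF _ _ P1); rewrite mul1g.
by split=> // x y Px /PV/(PF _ _ Px); rewrite invgK.
Qed.

Lemma powers_in (G : groupType) (Q : G -> Prop) (g x : G) :
  subgroup_prop Q -> Q g -> powers g x -> Q x.
Proof.
move=> [Q1 QM QV] Qg [a [b ->]].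
have Qn n : Q (g ^+ n)%g by elim: n => [|n IHn]; rewrite ?expg0 ?expgS //; apply: QM.
by apply: QM => //; apply: QV.
Qed.

Lemma powers_id (G : groupType) (g : G) : powers g g.
Proof. by exists 1%N, 0%N; rewrite expg0 invg1 mulg1. Qed.

Lemma cyclic_powers (G : groupType) : cyclic_group G -> exists g : G, forall x, powers g x.
Proof.
move=> [g /generated_cyclic gP]; exists g; apply: (gP _ (powers_subgroup g)) => s.
by rewrite inE => /eqP ->; apply: powers_id.
Qed.

Lemma cyclic_of_powers (L F : groupType) (f : {multiplicative L -> F}) (g : F) :
  injective f -> (forall x, powers g (f x)) -> cyclic_group L.
Proof.
move=> f_inj fg.
apply: (@int_subquotient_cyclic _ (fun m x =>
  exists a b : nat, m = a%:Z - b%:Z /\ f x = (g ^+ a * g ^- b)%g)).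
- move=> _ _ x y [a [b [-> fx]]] [c [d [-> fy]]].
  exists (a + d)%N, (c + b)%N; split; first by rewrite !PoszD; ring.
  by rewrite gmulfM gmorphV fx fy powersVM.
- by move=> x; have [a [b fx]] := fg x; exists (a%:Z - b%:Z), a, b.
move=> m x y [a [b [-> fx]]] [c [d [e fy]]]; apply: f_inj; rewrite fx fy.
by apply: expg_quotient_eq; apply/eqP; move: e; lia.
Qed.

(** A common denominator of the generators clears the denominators of all
    elements. *)
Lemma fg_rational_cyclic (G : groupType) (f : G -> rat) :
  {morph f : x y / (x * y)%g >-> x + y} -> injective f ->
  finitely_generated G -> cyclic_group G.
Proof.
move=> fM f_inj /fgP[S SP].
have f1 : f 1%g = 0 by apply: (addrI (f 1%g)); rewrite -fM mulg1 addr0.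
have fV x : f x^-1%g = - f x by apply: (addrI (f x)); rewrite -fM mulgV f1 subrr.
pose d : int := \prod_(s <- S) denq (f s).
have d0 : d != 0 by rewrite /d prodf_seq_neq0; apply/allP => s _; rewrite denq_neq0.
apply: (@int_subquotient_cyclic _ (fun m x => f x * d%:~R = m%:~R)).
- by move=> m n x y fx fy; rewrite fM fV mulrBl fx fy rmorphB.
- apply: SP => [|s sS].
    split=> [|x y [m fx] [n fy]|x [m fx]]; first by exists 0; rewrite f1 mul0r.
      by exists (m + n); rewrite fM mulrDl fx fy rmorphD.
    by exists (- m); rewrite fV mulNr fx rmorphN.
  have [q ->] : exists q, d = q * denq (f s).
    by rewrite /d (big_rem s) //= mulrC; eexists.
  by exists (q * numq (f s)); rewrite !rmorphM /= numqE mulrCA.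
move=> m x y fx fy; apply: f_inj; apply: (mulIf (x := d%:~R)); last by rewrite fx fy.
by rewrite intr_eq0.
Qed.

(** * Crossed homomorphisms on presented groups *)

Section PresentedGroups.
Variables (X : choiceType) (rel : word X -> word X -> Prop).
Local Notation F := (presented rel : groupType).

Lemma pres_class_cat u v : (pres_class rel (u ++ v) : F) = (pres_class rel u * pres_class rel v)%g.
Proof. exact/esym/pres_classM. Qed.

Lemma pres_class_inv x : (pres_class rel [:: (x, true)] : F) = (pres_gen rel x)^-1%g.
Proof.
apply: (mulgI (pres_gen rel x)); rewrite mulgV -pres_class_cat.
exact/pres_classP/(WordCancel rel x false).
Qed.

Lemma presented_ind (Q : F -> Prop) :
  subgroup_prop Q -> (forall x, Q (pres_gen rel x)) -> forall y, Q y.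
Proof.
move=> [Q1 QM QV] Qx y; rewrite -[y]pres_reprK.
elim: (pres_repr y) => [//|[x b] w IHw]; rewrite -cat1s pres_class_cat.
apply: QM => //; case: b; last exact: Qx.
by rewrite pres_class_inv; apply/QV/Qx.
Qed.

Section Action.
Variables (T : Type) (f f' : X -> T -> T).
Hypotheses (fK : forall x, cancel (f x) (f' x)) (f'K : forall x, cancel (f' x) (f x)).

Definition act_word (w : word X) (t : T) : T :=
  foldr (fun l t => if l.2 then f' l.1 t else f l.1 t) t w.

Hypothesis act_rel : forall u v, rel u v -> act_word u =1 act_word v.

Lemma act_word_eq u v : word_eq rel u v -> act_word u =1 act_word v.
Proof.
elim=> {u v} [u|u v _ uv|u v w _ uv _ vw|u u' v v' _ uu _ vv|x b|u v uv] t.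
- by [].
- by rewrite uv.
- by rewrite uv vw.
- by rewrite /act_word !foldr_cat -!/(act_word _ _) vv uu.
- by case: b => /=; rewrite ?fK ?f'K.
by apply: act_rel.
Qed.

Definition pres_act (x : F) : T -> T := act_word (pres_repr x).

Lemma pres_act_class w : pres_act (pres_class rel w) =1 act_word w.
Proof. exact/act_word_eq/pres_classK. Qed.

Lemma pres_actM x y t : pres_act (x * y)%g t = pres_act x (pres_act y t).
Proof.
by rewrite -{1}[x]pres_reprK -{1}[y]pres_reprK -pres_class_cat pres_act_class /act_word foldr_cat.
Qed.

End Action.

(** A crossed homomorphism to a permutation module is an action by affine maps,
    so that it can be prescribed on generators subject to the relations. *)
Section Derivation.
Variables (E : gset F) (d : X -> {malg int[E]}).

Definition der_letter x m := translate (pres_gen rel x) m + d x.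
Definition der_letterV x m := translate (pres_gen rel x)^-1%g (m - d x).
Definition der_word (w : word X) : {malg int[E]} := act_word der_letter der_letterV w 0.

Lemma der_word_cons l w : der_word (l :: w) =
  if l.2 then der_letterV l.1 (der_word w) else der_letter l.1 (der_word w).
Proof. by []. Qed.

Hypothesis der_rel : forall u v, rel u v -> der_word u = der_word v.

Lemma translateD h (m m' : {malg int[E]}) :
  translate h (m + m') = translate h m + translate h m'.
Proof. exact: raddfD. Qed.

Lemma der_word_gen0 x w : d x = 0 ->
  der_word ((x, false) :: w) = translate (pres_gen rel x) (der_word w).
Proof. by move=> dx; rewrite der_word_cons /= /der_letter dx addr0. Qed.

Lemma der_word_gen x : der_word [:: (x, false)] = d x.
Proof. by rewrite der_word_cons /= /der_letter translate0 add0r. Qed.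

Lemma der_word_conj x y : d y = 0 ->
  der_word [:: (x, false); (y, false); (x, true)] =
    d x - translate (pres_gen rel x * (pres_gen rel y * (pres_gen rel x)^-1))%g (d x).
Proof.
move=> dy; rewrite !der_word_cons /= /der_letter /der_letterV dy addr0 sub0r.
by rewrite !translateM !translateN addrC.
Qed.

Lemma der_letterK x : cancel (der_letter x) (der_letterV x).
Proof.
by move=> m; rewrite /der_letterV /der_letter addrK -translateM mulVg translate1.
Qed.

Lemma der_letterVK x : cancel (der_letterV x) (der_letter x).
Proof.
by move=> m; rewrite /der_letterV /der_letter -translateM mulgV translate1 subrK.
Qed.

(** The derivation is the translation part of the affine action. *)
Lemma act_word_affine w m :
  act_word der_letter der_letterV w m = translate (pres_class rel w) m + der_word w.
Proof.
rewrite /der_word; elim: w m => [|[x b] w IHw] m /=.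
  by rewrite addr0; have -> : pres_class rel [::] = 1%g :> F; rewrite // translate1.
rewrite IHw -cat1s pres_class_cat translateM; case: b => /=.
  by rewrite pres_class_inv /der_letterV -addrA translateD.
by rewrite /der_letter translateD addrA.
Qed.

Lemma derivationP : exists D : F -> {malg int[E]},
  (forall x y, D (x * y)%g = D x + translate x (D y)) /\
  (forall w, D (pres_class rel w) = der_word w).
Proof.
have act_rel u v : rel u v ->
    act_word der_letter der_letterV u =1 act_word der_letter der_letterV v.
  move=> uv m; rewrite !act_word_affine (der_rel uv).
  by have -> : pres_class rel u = pres_class rel v by exact/pres_classP/WordRel.
exists (fun x => pres_act der_letter der_letterV x 0); split=> [x y|w].
  rewrite (pres_actM der_letterK der_letterVK act_rel).
  by rewrite {1}/pres_act act_word_affine pres_reprK addrC.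
exact: (pres_act_class der_letterK der_letterVK act_rel).
Qed.

End Derivation.

End PresentedGroups.

(** * Coset graphs *)

Section CosetSets.
Local Open Scope quotient_scope.
Variables (F : groupType) (I : choiceType) (K : I -> F -> Prop).
Hypothesis KP : forall i, subgroup_prop (K i).

Definition coset_rel (p q : I * F) : bool := `[< p.1 = q.1 /\ K p.1 (p.2^-1 * q.2)%g >].

Fact coset_rel_refl : reflexive coset_rel.
Proof. by move=> [i x]; apply/asboolP; split=> //=; rewrite mulVg; case: (KP i). Qed.

Fact coset_rel_sym : symmetric coset_rel.
Proof.
have sub p q : coset_rel p q -> coset_rel q p.
  case: p q => [i x] [j y] /asboolP[/= <- Kxy]; apply/asboolP; split=> //=.
  by case: (KP i) => _ _ KV; have := KV _ Kxy; rewrite invgM invgK.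
by move=> p q; apply/idP/idP; apply: sub.
Qed.

Fact coset_rel_trans : transitive coset_rel.
Proof.
move=> [j y] [i x] [k z] /asboolP[/= <- Kxy] /asboolP[/= <- Kyz].
apply/asboolP; split=> //=; case: (KP i) => _ KM _; have := KM _ _ Kxy Kyz.
by rewrite mulgA mulgK.
Qed.

Canonical coset_equiv := EquivRel coset_rel coset_rel_refl coset_rel_sym coset_rel_trans.

Definition cosets : choiceType := {eq_quot coset_equiv}.

Definition cos (i : I) (x : F) : cosets := \pi_{eq_quot coset_equiv} (i, x).

Lemma cosP i x j y : cos i x = cos j y <-> i = j /\ K i (x^-1 * y)%g.
Proof. by split=> [/eqmodP/asboolP //|ij]; apply/eqmodP/asboolP. Qed.

Lemma cos_ind (Q : cosets -> Prop) : (forall i x, Q (cos i x)) -> forall q, Q q.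
Proof.
move=> Qc q; rewrite -[q](reprK (q : {eq_quot coset_equiv})).
by case: (repr _) => i x; apply: Qc.
Qed.

Lemma cos_mulr i x k : K i k -> cos i (x * k)%g = cos i x.
Proof.
move=> Kk; apply/cosP; split=> //; rewrite invgM mulgVK.
by case: (KP i) => _ _; apply.
Qed.

Definition cos_lift (T : Type) (f : I -> F -> T) (q : cosets) : T :=
  f (repr (q : {eq_quot coset_equiv})).1 (repr (q : {eq_quot coset_equiv})).2.

Lemma cos_liftE (T : Type) (f : I -> F -> T) i x :
  (forall x k, K i k -> f i (x * k)%g = f i x) -> cos_lift f (cos i x) = f i x.
Proof.
move=> fK; rewrite /cos_lift; have := reprK (cos i x).
case: (repr _) => j y /= /esym /cosP[<- Kxy].
by rewrite -[y](mulVKg x) fK.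
Qed.

Definition coset_act (h : F) : cosets -> cosets := cos_lift (fun i x => cos i (h * x)%g).

Lemma coset_actE h i x : coset_act h (cos i x) = cos i (h * x)%g.
Proof.
by rewrite /coset_act cos_liftE // => {}x k Kk; rewrite mulgA (cos_mulr _ Kk).
Qed.

Fact coset_act1 q : coset_act 1%g q = q.
Proof. by elim/cos_ind: q => i x; rewrite coset_actE mul1g. Qed.

Fact coset_actM g h q : coset_act (g * h)%g q = coset_act g (coset_act h q).
Proof. by elim/cos_ind: q => i x; rewrite !coset_actE mulgA. Qed.

Definition coset_gset : gset F := GSet coset_act1 coset_actM.

End CosetSets.

Section Pullback.
Variables (H F : groupType) (phi : {multiplicative H -> F}) (X : gset F).

Fact pull_act1 (x : X) : gs_act (phi 1%g) x = x.
Proof. by rewrite gmorph1 gs_act1. Qed.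

Fact pull_actM g h (x : X) : gs_act (phi (g * h)%g) x = gs_act (phi g) (gs_act (phi h) x).
Proof. by rewrite gmulfM gs_actM. Qed.

Definition pull_gset : gset H :=
  @GSet H X (fun h x => gs_act (phi h) x) pull_act1 pull_actM.

End Pullback.

(** The stabilizer of the coset [x K] is conjugated into [K] by [x]. *)
Lemma coset_stab_hom (H F L : groupType) (phi : {multiplicative H -> F})
    (incl : {multiplicative L -> H}) (x : F) (Q : F -> Prop) :
  injective phi -> injective incl ->
  (forall l, Q (x^-1 * (phi (incl l) * x))%g) ->
  exists psi : {multiplicative L -> F}, injective psi /\ forall l, Q (psi l).
Proof.
move=> phi_inj incl_inj Ql; pose psi l := (x^-1 * (phi (incl l) * x))%g.
have psiM : {morph psi : k l / (k * l)%g}.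
  by move=> k l; rewrite /psi !gmulfM !mulgA mulgK.
pose psiH : {multiplicative L -> F} := HB.pack psi (monoid.isMultiplicative.Build _ _ psi psiM).
exists psiH; split=> // k l.
by move=> /mulgI/mulIg/phi_inj/incl_inj.
Qed.

Section CosetForest.
Variables (F : groupType) (IV IE : choiceType) (s t : IE -> IV) (y : IE -> F).
Variables (KV : IV -> F -> Prop) (KE : IE -> F -> Prop).
Hypotheses (KVP : forall i, subgroup_prop (KV i)) (KEP : forall e, subgroup_prop (KE e)).
Hypothesis KEs : forall e k, KE e k -> KV (s e) k.
Hypothesis KEt : forall e k, KE e k -> KV (t e) ((y e)^-1 * (k * y e))%g.
Local Notation V := (coset_gset KVP).
Local Notation E := (coset_gset KEP).

Definition cos_src : E -> V := cos_lift (fun e x => cos KVP (s e) x).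
Definition cos_tgt : E -> V := cos_lift (fun e x => cos KVP (t e) (x * y e)%g).

Lemma cos_srcE e x : cos_src (cos KEP e x) = cos KVP (s e) x.
Proof. by rewrite /cos_src cos_liftE // => z k /KEs Kk; rewrite (cos_mulr KVP _ Kk). Qed.

Lemma cos_tgtE e x : cos_tgt (cos KEP e x) = cos KVP (t e) (x * y e)%g.
Proof.
rewrite /cos_tgt cos_liftE // => z k /KEt Kk.
rewrite -[RHS](cos_mulr KVP _ Kk); congr cos.
by rewrite !mulgA mulgK.
Qed.

Lemma cos_srcM h e : cos_src (gs_act h e) = gs_act h (cos_src e).
Proof. by elim/cos_ind: e => e x /=; rewrite coset_actE !cos_srcE coset_actE. Qed.

Lemma cos_tgtM h e : cos_tgt (gs_act h e) = gs_act h (cos_tgt e).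
Proof. by elim/cos_ind: e => e x /=; rewrite coset_actE !cos_tgtE coset_actE mulgA. Qed.

Variable D : F -> {malg int[E]}.
Hypothesis DM : forall x z, D (x * z)%g = D x + translate x (D z).
Hypothesis DV : forall i k, KV i k -> D k = 0.
Hypothesis DE : forall e, D (y e) = << cos KEP e 1%g >>.

(** The function [x K |-> D x] is well defined because [D] kills the vertex groups,
    and its values at the two ends of the edge [x] differ by [x * D (y e)], which
    is that edge: this is the section required by [forest_FP2]. *)
Theorem coset_forest_FP2 (H : groupType) (phi : {multiplicative H -> F}) (i0 : IV) :
  injective phi -> finitely_generated H ->
  (forall h, reach cos_src cos_tgt (fun=> True) (cos KVP i0 1%g) (cos KVP i0 (phi h))) ->
  (forall e, exists g, forall k, KE e k -> powers g k) ->
  (forall i (L : groupType) (psi : {multiplicative L -> F}), injective psi ->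
     (forall l, KV i (psi l)) -> finitely_generated L -> free_FP2 L) ->
  free_FP2 H.
Proof.
move=> phi_inj H_fg H_reach KE_cyc KV_FP2.
pose VH := pull_gset phi V; pose EH := pull_gset phi E.
have stab_hom (I : choiceType) (K : I -> F -> Prop) (KP : forall i, subgroup_prop (K i)) i x :
    exists psi : {multiplicative stabg (cos KP i x : pull_gset phi (coset_gset KP)) -> F},
      injective psi /\ forall l, K i (psi l).
  apply: (coset_stab_hom (x := x) phi_inj (@val_inj _ _ _ : injective (stab_val _))) => l.
  have := stab_valP l; rewrite /= coset_actE => /esym /cosP[_].
  by rewrite mulgA.
have secE i x : cos_lift (fun _ x => D x) (cos KVP i x) = D x.
  by rewrite cos_liftE // => z k /DV Dk; rewrite DM Dk translate0 addr0.
apply: (@forest_FP2 H VH EH cos_src cos_tgt _ _ (cos_lift (fun _ x => D x)) _ (cos KVP i0 1%g)).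
- by move=> h e; apply: cos_srcM.
- by move=> h e; apply: cos_tgtM.
- move=> e; elim/cos_ind: e => e x; rewrite cos_srcE cos_tgtE.
  by rewrite !secE DM addrC addKr DE translateU /= coset_actE mulg1.
- by move=> h; rewrite /= coset_actE mulg1.
- exact: H_fg.
- move=> e; elim/cos_ind: e => e x; apply: cyclic_FP2.
  have [psi [psi_inj psiK]] := stab_hom _ _ KEP e x; have [g gP] := KE_cyc e.
  by apply: (cyclic_of_powers psi_inj) => l; apply: gP.
move=> v; elim/cos_ind: v => i x; have [psi [psi_inj psiK]] := stab_hom _ _ KVP i x.
exact: KV_FP2 psi_inj psiK.
Qed.

End CosetForest.

(** * Subgroups of Baumslag-Solitar groups *)

Section ForestReach.
Variables (H : groupType) (V E : gset H) (st tt : E -> V) (v0 : V).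
Hypothesis stM : forall h e, st (gs_act h e) = gs_act h (st e).
Hypothesis ttM : forall h e, tt (gs_act h e) = gs_act h (tt e).
Local Notation conn := (reach st tt (fun=> True)).

Lemma reach_act h v w : conn v w -> conn (gs_act h v) (gs_act h w).
Proof.
elim=> [|e _ _ IH|e _ _ IH]; first exact: ReachBase.
  by rewrite -ttM; apply: ReachFwd => //; rewrite stM.
by rewrite -stM; apply: ReachBwd => //; rewrite ttM.
Qed.

Lemma reach_trans v w u : conn v w -> conn w u -> conn v u.
Proof. by move=> vw; elim=> // e _ _ IH; [apply: ReachFwd | apply: ReachBwd]. Qed.

Lemma reach_sym v w : conn v w -> conn w v.
Proof.
elim=> [|e _ _ IH|e _ _ IH]; first exact: ReachBase.
  apply: reach_trans IH; apply: (@ReachBwd _ _ st tt _ _ e) => //; exact: ReachBase.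
apply: reach_trans IH; apply: (@ReachFwd _ _ st tt _ _ e) => //; exact: ReachBase.
Qed.

(** Translates of paths may be concatenated, so connectedness of a coset graph
    only has to be checked on generators. *)
Lemma reach_subgroup : subgroup_prop (fun h => conn v0 (gs_act h v0)).
Proof.
split=> [|g h gP hP|h hP]; first by rewrite gs_act1; apply: ReachBase.
  by rewrite gs_actM; apply: reach_trans gP _; apply: reach_act.
by rewrite -{1}[v0](gs_actK h); apply/reach_act/reach_sym.
Qed.

Lemma derivation_kernel (D : H -> {malg int[E]}) :
  (forall x y, D (x * y)%g = D x + translate x (D y)) -> subgroup_prop (fun x => D x = 0).
Proof.
move=> DM; have D1 : D 1%g = 0.
  by apply: (addrI (D 1%g)); have := DM 1%g 1%g; rewrite translate1 mulg1 addr0.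
split=> // [x y Dx Dy|x Dx]; first by rewrite DM Dx Dy translate0 addr0.
have := DM x^-1%g x; rewrite mulVg D1 Dx translate0 addr0.
by move=> <-.
Qed.

End ForestReach.

Section BaumslagSolitar.
Variable m : int.
Local Notation rel := (bs_rel m).
Local Notation F := (BS1 m).
Let a : F := pres_gen rel false.
Let t : F := pres_gen rel true.

Lemma bs_nseq n b : powers a (pres_class rel (nseq n (bs_a b)) : F).
Proof.
have [P1 PM PV] := powers_subgroup a.
elim: n => [//|n IHn] /=; rewrite -cat1s pres_class_cat; apply: PM => //.
case: b {IHn}; last exact: powers_id.
by rewrite pres_class_inv; apply/PV/powers_id.
Qed.

Lemma bs_conj k : powers a k -> powers a (t^-1 * (k * t))%g.
Proof.
have [P1 PM PV] := powers_subgroup a.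
apply: (powers_in (Q := fun k => powers a (t^-1 * (k * t))%g)).
  split=> [|x y Qx Qy|x Qx].
- by rewrite mul1g mulVg.
- have -> : (t^-1 * (x * y * t) = (t^-1 * (x * t)) * (t^-1 * (y * t)))%g.
    by rewrite !mulgA mulgK.
  exact: PM.
- have -> : (t^-1 * (x^-1 * t) = (t^-1 * (x * t))^-1)%g.
    by rewrite !invgM invgK mulgA.
  exact: PV.
have -> : (t^-1 * (a * t))%g = pres_class rel [:: bs_t true; bs_a false; bs_t false].
  rewrite -[RHS]/(pres_class rel ([:: bs_t true] ++ [:: bs_a false] ++ [:: bs_t false])).
  by rewrite !pres_class_cat pres_class_inv.
have -> : pres_class rel [:: bs_t true; bs_a false; bs_t false] =
          pres_class rel (nseq `|m|%N (bs_a (m < 0))) by exact/pres_classP/WordRel.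
exact: bs_nseq.
Qed.

(** [BS(1, m)] acts on the tree whose vertices and edges are both the cosets of
    the cyclic group [<a>], the edge [x <a>] joining [x <a>] to [x t <a>]. *)
Theorem BS1_subgroup_FP2 (L : groupType) (f : {multiplicative L -> F}) :
  injective f -> finitely_generated L -> free_FP2 L.
Proof.
move=> f_inj L_fg.
have KP (_ : unit) := powers_subgroup a.
pose E := coset_gset KP; pose e1 : E := cos KP tt 1%g.
pose d (x : bool) : {malg int[E]} := if x then << e1 >> else 0.
have der_a n b : der_word d (nseq n (bs_a b)) = 0.
  elim: n => [//|n IHn]; rewrite [nseq _ _]/= der_word_cons IHn.
  by case: b {IHn} => /=; rewrite /der_letter /der_letterV /= ?subr0 ?addr0 translate0.
have e1a : gs_act a e1 = e1.
  have := cos_mulr KP (i := tt) 1%g (powers_id a).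
  by rewrite /= coset_actE mulg1 mul1g.
have [u v [] |D [DM DW]] := @derivationP _ rel E d.
  rewrite der_a !der_word_cons /= /der_letter /der_letterV translate0 add0r addr0.
  by rewrite translateU e1a subrr translate0.
apply: (@coset_forest_FP2 F unit unit id id (fun=> t) _ _ KP KP _ _ D _ _ _ _ f tt) => //.
- by move=> _; apply: bs_conj.
- move=> _ k; apply: (powers_in (Q := fun k => D k = 0)); first exact: derivation_kernel DM.
  by rewrite DW /der_word /= /der_letter /= translate0 addr0.
- by move=> []; rewrite DW /der_word /= /der_letter /= translate0 add0r.
- move=> h; move: (f h) => x.
  have -> : cos KP tt x = gs_act x e1 by rewrite /= coset_actE mulg1.
  have conjt (_ : unit) := bs_conj.
  apply: (presented_ind (Q := fun x => reach _ _ _ e1 (gs_act x e1))) x.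
    apply: reach_subgroup => ? ?; first exact: cos_srcM.
    exact: cos_tgtM.
  case; last by rewrite -/a e1a; apply: ReachBase.
  have -> : gs_act (pres_gen rel true) e1 = cos_tgt id (fun=> t) KP e1.
    by rewrite cos_tgtE //= coset_actE mulg1 mul1g.
  by apply: ReachFwd; rewrite // cos_srcE //; apply: ReachBase.
- by move=> _; exists a.
move=> _ L' psi psi_inj psiK _; apply: cyclic_FP2.
exact: cyclic_of_powers psi_inj psiK.
Qed.

End BaumslagSolitar.

(** * Vertex groups embed in the path group *)

Section Enumerations.

Lemma nat_enum (T : Type) (P : T -> Prop) (iota : T -> nat) (u : nat -> T) :
  injective iota -> injective u -> (forall i, P (u i)) ->
  exists dec : nat -> T,
    [/\ injective dec, forall i, P (dec i) & forall t, P t -> exists i, dec i = t].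
Proof.
move=> iota_inj u_inj Pu; pose A : set nat := fun n => exists2 t, P t & iota t = n.
have infA : cardinality.infinite_set A.
  apply/cardinality.infiniteP.
  apply: (@cardinality.card_le_trans _ _ _ ((iota \o u) @` setT)%classic).
    have : {in setT &, injective (iota \o u)} by move=> i j _ _ /= /iota_inj/u_inj.
    by move=> /cardinality.inj_card_eq; rewrite cardinality.card_eq_le => /andP[].
  by apply: cardinality.subset_card_le => _ [i _ <-]; exists (u i).
have /cardinality.card_esym/cardinality.card_set_bijP[f [f_fun f_inj f_surj]] :=
  cardinality.eq_card_nat (cardinality.countableP A) infA.
have /choice[dec decP] : forall i, exists t, P t /\ iota t = f i.
  by move=> i; have [t Pt ti] := f_fun i I; exists t.
exists dec; split=> [i j ij|i|t Pt]; first last.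
- have [i _ fi] := f_surj (iota t) (ex_intro2 _ _ t Pt erefl).
  by exists i; apply: iota_inj; rewrite (decP i).2.
- exact: (decP i).1.
by apply: f_inj; rewrite ?inE // -(decP i).2 -(decP j).2 ij.
Qed.

Lemma inj_surj_inverse (T U : Type) (f : T -> U) :
  injective f -> (forall y, exists x, f x = y) ->
  exists g, cancel f g /\ cancel g f.
Proof. by move=> f_inj /choice[g gP]; exists g; split=> // x; apply: f_inj. Qed.

(** The subgroup [C] acts freely on [G * nat], and the orbits are indexed by the
    product of a transversal with [nat], which is countably infinite whatever the
    index of [C] is; so [G * nat] does not depend on [G] as a [C]-set. *)
Lemma free_restriction (G C : groupType) (c : {multiplicative C -> G}) (iota : G -> nat) :
  injective iota -> injective c ->
  exists (f : C * nat -> G * nat) (g : G * nat -> C * nat),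
    [/\ cancel f g, cancel g f
      & forall x y n, f ((x * y)%g, n) = ((c x * (f (y, n)).1)%g, (f (y, n)).2)].
Proof.
move=> iota_inj c_inj; pose r (x : G) := ((lcoset_repr c x^-1)^-1)%g.
have rE x : exists k, x = (c k * r x)%g.
  have [k xk] := lcoset_reprP c x^-1%g; exists k^-1%g.
  by rewrite /r gmorphV -invgM -xk invgK.
have rM k x : r (c k * x)%g = r x.
  rewrite /r; congr (_^-1)%g; apply/esym/eq_lcoset_repr.
  by exists k^-1%g; rewrite invgM gmorphV.
have rr x : r (r x) = r x by have [k {2}->] := rE x; rewrite rM.
have [||i|dec [dec_inj decP dec_surj]] := @nat_enum (G * nat) (fun t => r t.1 = t.1)
  (fun t => choice.pickle (iota t.1, t.2)) (fun i => (r 1%g, i)).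
- by move=> [x i] [y j] /(pcan_inj choice.pickleK)[/iota_inj -> ->].
- by move=> i j [].
- exact: rr.
pose f (p : C * nat) : G * nat := ((c p.1 * (dec p.2).1)%g, (dec p.2).2).
have [g [fK gK]] : exists g, cancel f g /\ cancel g f.
  apply: inj_surj_inverse => [[x i] [y j] [/= xy ij]|[x n]].
    have dij : dec i = dec j.
      have : r (dec i).1 = r (dec j).1 by rewrite -(rM x) xy rM.
      by rewrite !decP; move: ij; case: (dec i) (dec j) => ? ? [? ?] /= -> ->.
    by move: xy; rewrite dij => /mulIg/c_inj ->; rewrite (dec_inj _ _ dij).
  have [k xk] := rE x; have [i di] := dec_surj (r x, n) (rr x).
  by exists (k, i); rewrite /f /= di /= -xk.
by exists f, g; split=> // x y n; rewrite /f /= gmulfM mulgA.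
Qed.

End Enumerations.

Section VertexGroups.
Variable A : graph_of_groups.
Hypothesis countable_vertex : forall v : gog_vertex A,
  exists iota : vertex_group v -> nat, injective iota.

(** All vertex groups act freely on [nat], and the edge generators can be made
    to act as permutations of [nat] that intertwine the two actions of the edge
    groups; so the path group acts on [nat] and this action separates the
    elements of each vertex group. *)
Lemma vertex_elt_inj (v : gog_vertex A) : injective (@vertex_elt A v).
Proof.
have enum_ex (w : gog_vertex A) : exists b : (nat -> vertex_group w * nat) *
    (vertex_group w * nat -> nat), cancel b.1 b.2 /\ cancel b.2 b.1.
  have [iota iota_inj] := countable_vertex w.
  have [||i|dec [dec_inj _ dec_surj]] := @nat_enum (vertex_group w * nat) (fun=> True)
    (fun t => choice.pickle (iota t.1, t.2)) (fun i => (1%g, i)).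
  - by move=> [x i] [y j] /(pcan_inj choice.pickleK)[/iota_inj -> ->].
  - by move=> i j [].
  - by [].
  have [t|g [dK gK]] := inj_surj_inverse dec_inj; first exact: dec_surj.
  by exists (dec, g).
pose b w := (projT1 (cid (enum_ex w))).1.
pose b' w := (projT1 (cid (enum_ex w))).2.
have bK w : cancel (b w) (b' w) := (projT2 (cid (enum_ex w))).1.
have b'K w : cancel (b' w) (b w) := (projT2 (cid (enum_ex w))).2.
(* The action of the vertex group at [w] on [nat]. *)
pose al w (g : vertex_group w) (n : nat) : nat := b' w ((g * (b w n).1)%g, (b w n).2).
have alM w g h n : al w (g * h)%g n = al w g (al w h n) by rewrite /al b'K mulgA.
have al1 w n : al w 1%g n = n by rewrite /al mul1g -surjective_pairing bK.
(* The permutation of [nat] by which the edge [e] acts. *)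
have theta_ex (e : gog_edge A) : exists f : (nat -> nat) * (nat -> nat),
    [/\ cancel f.1 f.2, cancel f.2 f.1
      & forall c n, f.1 (al _ (tgt_mono e c) n) = al _ (src_mono e c) (f.1 n)].
  have [i_s is_inj] := countable_vertex (gog_src e).
  have [i_t it_inj] := countable_vertex (gog_tgt e).
  have [fs [gs [fsK gsK fsM]]] := free_restriction is_inj (@src_mono_inj A e).
  have [ft [gt [ftK gtK ftM]]] := free_restriction it_inj (@tgt_mono_inj A e).
  exists (fun n => b' _ (fs (gt (b _ n))), fun n => b' _ (ft (gs (b _ n)))).
  split=> [n|n|c n] /=; rewrite ?b'K ?fsK ?gtK ?ftK ?gsK ?bK //.
  rewrite /al !b'K; congr (b' _ _).
  case E: (gt (b _ n)) => [y k]; rewrite -fsM; congr fs.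
  apply: (can_inj ftK); rewrite gtK ftM -E gtK.
  by [].
pose th e := (projT1 (cid (theta_ex e))).1.
pose th' e := (projT1 (cid (theta_ex e))).2.
pose f (x : path_gen A) : nat -> nat :=
  match x with inl p => al (projT1 p) (projT2 p) | inr e => th e end.
pose f' (x : path_gen A) : nat -> nat :=
  match x with inl p => al (projT1 p) (projT2 p)^-1%g | inr e => th' e end.
have fK x : cancel (f x) (f' x).
  case: x => [[w g]|e] n /=; first by rewrite -alM mulVg al1.
  by have [thK _ _] := projT2 (cid (theta_ex e)); apply: thK.
have f'K x : cancel (f' x) (f x).
  case: x => [[w g]|e] n /=; first by rewrite -alM mulgV al1.
  by have [_ thK _] := projT2 (cid (theta_ex e)); apply: thK.
have act_rel x y : @path_rel A x y -> act_word f f' x =1 act_word f f' y.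
  case=> [w g h|e c] n /=; first by rewrite alM.
  have [_ thK thM] := projT2 (cid (theta_ex e)).
  by rewrite /th thM; congr al; apply: thK.
move=> g h /pres_classP/(act_word_eq fK f'K act_rel)/(_ (b' v (1%g, 0%N))) /=.
by rewrite /al !b'K !mulg1 => /(can_inj (b'K v))[].
Qed.

End VertexGroups.

(** * Groups acting on the forest of a graph of groups *)

Section PathGroup.
Variable A : graph_of_groups.
Local Notation F := (path_group A).

Definition vertex_image (v : gog_vertex A) (x : F) := exists g, x = @vertex_elt A v g.
Definition edge_image (e : gog_edge A) (x : F) := exists c, x = vertex_elt (src_mono e c).

Lemma vertex_image_subgroup v : subgroup_prop (vertex_image v).
Proof.
split=> [|_ _ [g ->] [h ->]|_ [g ->]]; first by exists 1%g; rewrite vertex_elt1.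
  by exists (g * h)%g; rewrite vertex_eltM.
by exists g^-1%g; rewrite vertex_eltV.
Qed.

Lemma edge_image_subgroup e : subgroup_prop (edge_image e).
Proof.
split=> [|_ _ [c ->] [c' ->]|_ [c ->]].
- by exists 1%g; rewrite gmorph1 vertex_elt1.
- by exists (c * c')%g; rewrite gmulfM vertex_eltM.
by exists c^-1%g; rewrite gmorphV vertex_eltV.
Qed.

Lemma edge_conj e c :
  (edge_elt e * (vertex_elt (tgt_mono e c) * (edge_elt e)^-1))%g =
    vertex_elt (src_mono e c) :> F.
Proof.
have e1 : pres_class (@path_rel A) ([:: (edge_letter e, false)] ++
      [:: (vertex_letter (tgt_mono e c), false)] ++ [:: (edge_letter e, true)]) =
    pres_class (@path_rel A) [:: (vertex_letter (src_mono e c), false)].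
  by apply/pres_classP/WordRel; apply: PathEdge.
by rewrite !pres_class_cat pres_class_inv in e1.
Qed.

Lemma edge_image_src e k : edge_image e k -> vertex_image (gog_src e) k.
Proof. by move=> [c ->]; exists (src_mono e c). Qed.

Lemma edge_image_tgt e k :
  edge_image e k -> vertex_image (gog_tgt e) ((edge_elt e)^-1 * (k * edge_elt e))%g.
Proof. by move=> [c ->]; exists (tgt_mono e c); rewrite -edge_conj !mulgA mulVg mul1g mulgVK. Qed.

Local Notation V := (coset_gset vertex_image_subgroup).
Local Notation E := (coset_gset edge_image_subgroup).
Local Notation vcos := (cos vertex_image_subgroup).
Local Notation ecos := (cos edge_image_subgroup).

(** The value on the edge relation is [e - (e c e^-1) e], which vanishes because
    [e c e^-1] lies in the edge group that fixes the edge. *)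
Lemma path_derivation : exists D : F -> {malg int[E]},
  [/\ forall x z, D (x * z)%g = D x + translate x (D z),
      forall v k, vertex_image v k -> D k = 0
    & forall e, D (edge_elt e) = << ecos e 1%g >>].
Proof.
pose d (x : path_gen A) : {malg int[E]} :=
  if x is inr e then << ecos e 1%g : E >> else 0.
have dv v g : d (@vertex_letter A v g) = 0 by [].
have de e : d (edge_letter e) = << ecos e 1%g : E >> by [].
move: d dv de => d dv de.
have [u v [w g h|e c]|D [DM DW]] := @derivationP _ (@path_rel A) E d.
- by rewrite der_word_gen0 // !der_word_gen !dv translate0.
- rewrite der_word_conj // der_word_gen dv de.
  rewrite [X in translate X _](edge_conj c) translateU /= coset_actE.
  have := cos_mulr edge_image_subgroup (i := e) 1%g (ex_intro _ c erefl).
  by rewrite mul1g mulg1 => ->; apply: subrr.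
exists D; split=> // [v _ [g ->]|e]; rewrite DW; last by rewrite der_word_gen de.
by rewrite der_word_gen dv.
Qed.

(** An element carried by a path is the end of the lift of that path that starts
    at the trivial coset. *)
Lemma path_elt_reach (u v : gog_vertex A) (x : F) : path_elt u v x ->
  reach (cos_src (@gog_src A) vertex_image_subgroup (KEP := edge_image_subgroup))
    (cos_tgt (@gog_tgt A) (@edge_elt A) vertex_image_subgroup (KEP := edge_image_subgroup))
    (fun=> True) (vcos u 1%g) (vcos v x).
Proof.
elim=> [g|e {}x g _ IH|e {}x g _ IH].
- rewrite -[vertex_elt g]mul1g cos_mulr; first exact: ReachBase.
  by exists g.
- rewrite cos_mulr; last by exists g.
  rewrite -(cos_tgtE _ edge_image_subgroup edge_image_tgt).
  by apply: ReachFwd; rewrite // cos_srcE //; apply: edge_image_src.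
rewrite cos_mulr; last by exists g.
rewrite -(cos_srcE _ edge_image_subgroup edge_image_src).
apply: ReachBwd; rewrite // cos_tgtE ?mulgVK //; exact: edge_image_tgt.
Qed.

(** The elements of [H] are carried by loops at [P], so only the component of the
    coset of [P] in the forest matters. *)
Theorem path_group_FP2 (P : gog_vertex A) (H : groupType)
    (phi : {multiplicative H -> F}) :
  injective phi -> (forall h, path_elt P P (phi h)) ->
  (forall v : gog_vertex A, injective (@vertex_elt A v)) ->
  (forall e : gog_edge A, cyclic_group (edge_group e)) ->
  (forall (v : gog_vertex A) (L : groupType) (psi : {multiplicative L -> vertex_group v}),
     injective psi -> finitely_generated L -> free_FP2 L) ->
  finitely_generated H -> free_FP2 H.
Proof.
move=> phi_inj phiP v_inj e_cyc v_FP2 H_fg.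
have [D [DM DV DE]] := path_derivation.
apply: (coset_forest_FP2 (KVP := vertex_image_subgroup) (i0 := P)
  edge_image_src edge_image_tgt DM DV DE phi_inj) => //.
- by move=> h; apply: path_elt_reach.
- move=> e; have [c cP] := cyclic_powers (e_cyc e).
  exists (vertex_elt (src_mono e c)) => _ [x ->].
  apply: (powers_in (Q := fun x => powers _ (vertex_elt (src_mono e x))) _ _ (cP x)).
    have [P1 PM PV] := powers_subgroup (vertex_elt (src_mono e c)).
    split=> [|y z Py Pz|y Py]; first by rewrite gmorph1 vertex_elt1.
      by rewrite gmulfM vertex_eltM; apply: PM.
    by rewrite gmorphV vertex_eltV; apply: PV.
  exact: powers_id.
move=> v L psi psi_inj /choice[chi chiP] L_fg.
have chiM : {morph chi : k l / (k * l)%g}.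
  by move=> k l; apply: (v_inj v); rewrite vertex_eltM -!chiP gmulfM.
pose chiH : {multiplicative L -> vertex_group v} :=
  HB.pack chi (monoid.isMultiplicative.Build _ _ chi chiM).
apply: (v_FP2 v L chiH) => // k l /= kl.
by apply: psi_inj; rewrite !chiP kl.
Qed.

End PathGroup.

Lemma rat_or_BS_countable (G : groupType) :
  isomorphic_to_subgroup_of_rat G \/ is_solvable_BS G ->
  exists iota : G -> nat, injective iota.
Proof.
move=> [[B [f [_ f_inj _]]]|[m [_ [f /bij_inj f_inj]]]].
  by exists (fun g => choice.pickle (f g)) => g h /(pcan_inj choice.pickleK)/f_inj.
exists (fun g => choice.pickle (pres_repr (f g : presented (bs_rel m)) : seq (bool * bool))).
move=> g h /(pcan_inj choice.pickleK) e; apply: f_inj.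
by rewrite -[f g]pres_reprK -[f h]pres_reprK e.
Qed.

(** Finitely generated subgroups of these groups are cyclic in the first case,
    and act on the tree of cosets of [<a>] in the second. *)
Lemma rat_or_BS_FP2 (G L : groupType) (psi : {multiplicative L -> G}) :
  isomorphic_to_subgroup_of_rat G \/ is_solvable_BS G ->
  injective psi -> finitely_generated L -> free_FP2 L.
Proof.
move=> [[B [f [fM f_inj _]]]|[m [_ [f /bij_inj f_inj]]]] psi_inj L_fg.
  apply/cyclic_FP2/(fg_rational_cyclic (f := f \o psi)) => //.
    by move=> x y /=; rewrite gmulfM fM.
  exact: inj_comp.
apply: (@BS1_subgroup_FP2 m L (f \o psi)) => //.
exact: inj_comp.
Qed.

Theorem corollary2 (R : realType) (A : graph_of_groups) (P : gog_vertex A)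
  (edge_cyclic : forall e : gog_edge A, cyclic_group (edge_group e))
  (vertex_cases : forall v : gog_vertex A,
     isomorphic_to_subgroup_of_rat (vertex_group v) \/
     is_solvable_BS (vertex_group v))
  (azd : analytic_zero_divisor_conjecture R (fundamental_group P)) :
  almost_coherent (fundamental_group P).
Proof.
move=> H H_fg; apply: free_FP2_type_FP.
pose incl : {multiplicative subgrp H -> fundamental_group P} := val.
pose incl' : {multiplicative fundamental_group P -> path_group A} := val.
apply: (@path_group_FP2 A P (subgrp H) (incl' \o incl)) => //.
- by move=> x y /val_inj/val_inj.
- by move=> h; have /asboolP := valP (val h).
- by apply: vertex_elt_inj => v; apply/rat_or_BS_countable/vertex_cases.
by move=> v L psi; apply: rat_or_BS_FP2.
Qed.
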